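(* Fix a positive integer $d$. For every $\epsilon > 0$, the parameterized minimization problem \textsc{Connected Dominating Set} (CDS), parameterized by solution size $k$, admits a $(1+\epsilon)$-approximate kernel with $k^{\mathcal{O}(d^2/\epsilon)}$ vertices on the class of $K_{d,d}$-free graphs (graphs not containing the complete bipartite graph $K_{d,d}$ as a subgraph).
   Context: All graphs are finite, undirected and simple. A set $D\subseteq V(G)$ dominates $G$ if every vertex is in $D$ or has a neighbor in $D$; it is a connected dominating set if moreover $G[D]$ is connected. CDS is the parameterized minimization problem with value $\mathrm{CDS}(G,k,S)=\infty$ if $S$ is not a connected dominating set of $G$, and $\min\{|S|,k+1\}$ otherwise; $\mathrm{OPT}(G,k)$ is the minimum value over all solutions. For a parameterized minimization problem $\Pi$ and $\alpha>1$, an $\alpha$-approximate polynomial-time preprocessing algorithm is a pair of polynomial-time algorithms: a reduction algorithm mapping an instance $(I,k)$ to an instance $(I',k')$, and a solution lifting algorithm which, given $(I,k)$, $(I',k')$ and a solution $s'$ of $(I',k')$, outputs a solution $s$ of $(I,k)$ with $\frac{\Pi(I,k,s)}{\mathrm{OPT}(I,k)}\le \alpha\cdot\frac{\Pi(I',k',s')}{\mathrm{OPT}(I',k')}$. An $\alpha$-approximate kernel is such an algorithm for which the size of the output instance is bounded by a function of $k$ (here: the number of vertices of the output graph is bounded as stated), the output being an instance of the same problem. *)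

(* Defs.v *)
(* MathComp / MathComp-Analysis *)
From HB Require Import structures.
From mathcomp Require Import all_boot all_order all_algebra.
From mathcomp Require Import reals constructive_ereal exp.

Set Implicit Arguments.
Unset Strict Implicit.
Unset Printing Implicit Defensive.

Import Order.TTheory GRing.Theory Num.Theory.
Local Open Scope ring_scope.

(** * Polynomial-time computation

    The machine model is a first-order call-by-value recursive language over
    binary trees (N. D. Jones's language F, with [let]).  A program is a list
    of one-argument function bodies; variables are de Bruijn indices, and the
    body of a called function sees its argument only, as [EVar 0]. *)

Inductive tree : Type := Leaf | Node of tree & tree.

Fixpoint tree_size (t : tree) : nat :=
  if t is Node l r then (tree_size l + tree_size r).+1 else 1%N.

Definition thd (t : tree) : tree := if t is Node l _ then l else Leaf.
Definition ttl (t : tree) : tree := if t is Node _ r then r else Leaf.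

Inductive expr : Type :=
| EVar of nat
| ENil
| ECons of expr & expr
| EHd of expr
| ETl of expr
| EIf of expr & expr & expr
| ELet of expr & expr
| ECall of nat & expr.

Definition program : Type := seq expr.

(** [eval p env e v t]: in environment [env], expression [e] evaluates to [v]
    in time [t].  Producing a tree costs its full size (so sharing of subtrees
    is not free) and control steps cost 1.  The size of all data handled is
    hence bounded by the size of the input plus the time, and this time measure
    and that of Turing machines are polynomially related, for decision and
    function problems alike. *)
Inductive eval (p : program) : seq tree -> expr -> tree -> nat -> Prop :=
| EvVar env i :
    eval p env (EVar i) (nth Leaf env i) (tree_size (nth Leaf env i))
| EvNil env :
    eval p env ENil Leaf 1
| EvCons env e1 e2 v1 v2 t1 t2 :
    eval p env e1 v1 t1 -> eval p env e2 v2 t2 ->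
    eval p env (ECons e1 e2) (Node v1 v2) (t1 + t2 + tree_size (Node v1 v2))
| EvHd env e v t :
    eval p env e v t -> eval p env (EHd e) (thd v) (t + tree_size (thd v))
| EvTl env e v t :
    eval p env e v t -> eval p env (ETl e) (ttl v) (t + tree_size (ttl v))
| EvIfTrue env e e1 e2 l r v t t1 :
    eval p env e (Node l r) t -> eval p env e1 v t1 ->
    eval p env (EIf e e1 e2) v (t + t1).+1
| EvIfFalse env e e1 e2 v t t2 :
    eval p env e Leaf t -> eval p env e2 v t2 ->
    eval p env (EIf e e1 e2) v (t + t2).+1
| EvLet env e1 e2 v1 v2 t1 t2 :
    eval p env e1 v1 t1 -> eval p (v1 :: env) e2 v2 t2 ->
    eval p env (ELet e1 e2) v2 (t1 + t2).+1
| EvCall env f e v w t t' :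
    eval p env e v t -> eval p [:: v] (nth ENil p f) w t' ->
    eval p env (ECall f e) w (t + t').+1.

(** [polytime dom inp out]: one program maps the code [inp a] to the code
    [out a] in polynomial time, for all [a] in the promise set [dom].  The entry
    point is function 0; since [tree_size] is at least 1, every polynomial is
    dominated by some [c * _ ^ c]. *)
Definition polytime (A : Type) (dom : A -> Prop) (inp out : A -> tree) : Prop :=
  exists (p : program) (c : nat), forall a : A, dom a ->
    exists2 t : nat, eval p [:: inp a] (nth ENil p 0) (out a) t
                   & (t <= c * tree_size (inp a) ^ c)%N.

Definition tbool (b : bool) : tree := if b then Node Leaf Leaf else Leaf.
Definition tnat (n : nat) : tree := iter n (Node Leaf) Leaf.
Definition tlist (s : seq tree) : tree := foldr Node Leaf s.

(** * Parameterized minimization problems and approximate kernels *)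

Record pmin_problem (R : realType) := PMinProblem {
  inst : Type;
  sol : inst -> finType;
  inst_code : inst -> tree;
  sol_code : forall I : inst, sol I -> tree;
  value : forall I : inst, nat -> sol I -> \bar R
}.
Arguments inst_code {R} p _.
Arguments sol_code {R} p {I} _.
Arguments value {R} p I _ _.

Section ApproximateKernels.
Variables (R : realType) (P : pmin_problem R).

Definition opt (I : inst P) (k : nat) : \bar R :=
  \big[Order.min/+oo%E]_(s : sol I) value P I k s.

(** The quotient of a value by the optimum.  An optimal solution has ratio 1
    even when the quotient is not defined (0/0 or oo/oo); otherwise this is
    the quotient of [\bar R], where x / 0 = +oo for x > 0. *)
Definition ratio (v o : \bar R) : \bar R := if v == o then 1%E else (v / o)%E.

(** The parameter is coded in unary. *)
Definition input_code (x : inst P * nat) : tree :=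
  Node (inst_code P x.1) (tnat x.2).

(** An [alpha]-approximate polynomial-time preprocessing algorithm for the
    restriction of [P] to the instances in [C]: a reduction algorithm [red] and
    a solution lifting algorithm [lift]. *)
Definition approx_preprocessing (C : inst P -> Prop) (alpha : R)
    (red : inst P * nat -> inst P * nat)
    (lift : forall x : inst P * nat, sol (red x).1 -> sol x.1) : Prop :=
  [/\ forall x, C x.1 -> C (red x).1,
      polytime (fun x => C x.1) input_code (fun x => input_code (red x)),
      polytime (fun y : {x : inst P * nat & sol (red x).1} => C (tag y).1)
        (fun y => Node (input_code (tag y))
                       (Node (input_code (red (tag y))) (sol_code P (tagged y))))
        (fun y => sol_code P (lift (tag y) (tagged y)))
    & forall (x : inst P * nat) (s' : sol (red x).1), C x.1 ->
        (ratio (value P x.1 x.2 (lift x s')) (opt x.1 x.2) <=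
         alpha%:E * ratio (value P (red x).1 (red x).2 s')
                          (opt (red x).1 (red x).2))%E].

(** An [alpha]-approximate kernel whose output instance has [mu]-size at most
    [f k], [mu] being some measure of instances. *)
Definition approx_kernel (C : inst P -> Prop) (alpha : R)
    (mu : inst P -> nat) (f : nat -> R) : Prop :=
  exists (red : inst P * nat -> inst P * nat)
         (lift : forall x : inst P * nat, sol (red x).1 -> sol x.1),
    [/\ @approx_preprocessing C alpha red lift,
        exists g : nat -> nat,
          forall x, C x.1 -> (tree_size (input_code (red x)) <= g x.2)%N
      & forall x, C x.1 -> (mu (red x).1)%:R <= f x.2].

End ApproximateKernels.

Arguments approx_preprocessing {R P} C alpha red lift.

(** * Connected dominating sets *)

Record graph := Graph {
  nverts : nat;
  adj : rel 'I_nverts;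
  adj_sym : symmetric adj;
  adj_irr : irreflexive adj
}.

(** The rows of the adjacency matrix. *)
Definition graph_code (G : graph) : tree :=
  tlist [seq tlist [seq tbool (adj i j) | j <- enum 'I_(nverts G)]
        | i <- enum 'I_(nverts G)].

(** The characteristic vector. *)
Definition vset_code (G : graph) (S : {set 'I_(nverts G)}) : tree :=
  tlist [seq tbool (i \in S) | i <- enum 'I_(nverts G)].

Definition dominates (G : graph) (D : {set 'I_(nverts G)}) : bool :=
  [forall v, (v \in D) || [exists u in D, adj u v]].

Definition induced_adj (G : graph) (D : {set 'I_(nverts G)}) :
    rel 'I_(nverts G) :=
  [rel u v | [&& u \in D, v \in D & adj u v]].

Definition induced_connected (G : graph) (D : {set 'I_(nverts G)}) : bool :=
  [forall u in D, forall v in D, connect (induced_adj D) u v].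

Definition connected_dominating (G : graph) (D : {set 'I_(nverts G)}) : bool :=
  dominates D && induced_connected D.

Definition CDS (R : realType) : pmin_problem R :=
  @PMinProblem R graph (fun G => {set 'I_(nverts G)} : finType)
    graph_code vset_code
    (fun G k S => if connected_dominating S then ((minn #|S| k.+1)%:R)%:E
                  else +oo%E).

(** [G] does not contain K_(d,d) as a (not necessarily induced) subgraph. *)
Definition biclique_free (d : nat) (G : graph) : Prop :=
  ~ exists A B : {set 'I_(nverts G)},
      [/\ #|A| = d, #|B| = d, [disjoint A & B]
        & forall a b, a \in A -> b \in B -> adj a b].

(* Main.v *)
Require Import Defs.
From mathcomp Require Import all_boot all_order all_algebra.
From mathcomp Require Import reals constructive_ereal exp.
From mathcomp Require Import zify ring lra.
Import Order.TTheory GRing.Theory Num.Theory.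

(** A core is a set Z of vertices such that at most k vertices that dominate Z
    dominate the whole graph.  Starting from W = Z, replace W by W ∩ N[x] as
    long as this is a proper subset with at least (|W| - 1)/k elements.  Once W
    is stuck, at most k vertices dominate all of W but one vertex w only if one
    of them is adjacent to all of W, so that w can be dropped from Z.  If no
    vertex can be dropped, W has shrunk to at most one vertex, and since d
    distinct vertices have fewer than 2d common neighbours, |Z| = O(d k^d).
    Call vertices twins if their closed neighbourhoods have the same trace on
    Z; there are at most 2d (|Z| + 1)^d traces.

    The kernel is induced by Z and by one representative of each connected
    t-tuple of vertices up to twins, where t = O(1/eps).  A spanning tree of a
    connected dominating set D splits into connected pieces of size less than t
    that overlap in single vertices, about |D|/r of them for r close to t/2.
    Replace each piece by its representative and reconnect consecutive pieces
    through a vertex of Z adjacent to both; this costs at most 4 more vertices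
    per piece, that is at most eps |D| in total.  The twins of D dominate Z,
    hence the graph. *)

Set Implicit Arguments.
Unset Strict Implicit.
Unset Printing Implicit Defensive.

(** The parameter stays [k], and lifting is the easy direction. A connected dominating set of the
    kernel with at most [k] vertices is one of the graph: the kernel is an induced subgraph
    containing the core, so connectivity carries over and the core is dominated. A larger one has
    value k + 1, which no lifted connected dominating set exceeds. What remains is to find a cheap
    solution inside the kernel.

    The obstacle there is that twins see the same vertices of Z, but possibly different vertices
    elsewhere, so replacing single vertices by twins destroys connectivity. Hence whole connected
    tuples are replaced, and different tuples touch only through Z, where twins agree. The contacts
    exist because the vertices of D with a neighbour in Z already dominate Z, hence everything:
    every vertex of D has such a vertex of D in its closed neighbourhood.

    Tuples have constant length t, so all of them can be listed in polynomial time. The algorithms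
    work on lists of naturals with a reflexive relation [nb], whose classes are the closed
    neighbourhoods. *)

Class encodable (A : Type) := enc : A -> tree.
#[export] Instance enc_unit : encodable unit := fun=> Leaf.
#[export] Instance enc_bool : encodable bool := tbool.
#[export] Instance enc_nat : encodable nat := tnat.
#[export] Instance enc_prod A B `{encodable A} `{encodable B} :
  encodable (A * B) := fun x => Node (enc x.1) (enc x.2).
#[export] Instance enc_seq A `{encodable A} : encodable (seq A) :=
  fun s => tlist (map enc s).

(** * Sizes of encodings *)

Definition esize A `{encodable A} (a : A) : nat := tree_size (enc a).

Lemma leq_expl e m n : m <= n -> m ^ e <= n ^ e.
Proof. by case: e => // e le_mn; rewrite leq_exp2r. Qed.

Lemma tree_size_gt0 t : 0 < tree_size t. Proof. by case: t. Qed.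

Lemma esize_gt0 A `{encodable A} (a : A) : 0 < esize a.
Proof. exact: tree_size_gt0. Qed.

Lemma esize_pair A B `{encodable A} `{encodable B} (a : A) (b : B) :
  esize (a, b) = (esize a + esize b).+1.
Proof. by []. Qed.

Lemma esize_cons A `{encodable A} (a : A) s :
  esize (a :: s) = (esize a + esize s).+1.
Proof. by []. Qed.

Lemma esize_bool (b : bool) : esize b <= 3.
Proof. by case: b. Qed.

Lemma esize_nat (n : nat) : esize n = n.*2.+1.
Proof.
by elim: n => // n; rewrite /esize /= => ->; rewrite doubleS; lia.
Qed.

Lemma size_esize A `{encodable A} (s : seq A) : size s < esize s.
Proof. by elim: s => // a s IHs; rewrite esize_cons /=; lia. Qed.

Lemma esize_subseq (A : eqType) `{encodable A} (s1 s2 : seq A) :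
  subseq s1 s2 -> esize s1 <= esize s2.
Proof.
elim: s2 s1 => [|b s2 IHs] [|a s1] //.
rewrite /= esize_cons; case: eqP => [->|_] /IHs le.
  by rewrite esize_cons ltnS leq_add2l.
by rewrite (leq_trans le) // ltnW // ltnS leq_addl.
Qed.

Lemma esize_behead A `{encodable A} (s : seq A) : esize (behead s) <= esize s.
Proof. by case: s => // a s; rewrite esize_cons ltnW // ltnS leq_addl. Qed.

Lemma esize_catr A `{encodable A} (s1 s2 : seq A) : esize s2 <= esize (s1 ++ s2).
Proof.
elim: s1 => //= a s1 IHs; rewrite esize_cons (leq_trans IHs) // ltnW // ltnS.
exact: leq_addl.
Qed.

Lemma esize_cat A `{encodable A} (s1 s2 : seq A) :
  esize (s1 ++ s2) <= esize s1 + esize s2.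
Proof. by elim: s1 => [|a s IHs] /=; rewrite ?esize_cons; lia. Qed.

(** * Polynomial bounds *)

(** One constant serves as factor and exponent: sizes are positive, so raising either only weakens
    the bound. *)
Definition polyb A `{encodable A} (T : A -> nat) : Prop :=
  exists c, forall a, T a <= c * esize a ^ c.

Section Poly.
Context {A : Type} {EA : encodable A}.
Implicit Types (S T : A -> nat).

Lemma polyb_le S T : (forall a, S a <= T a) -> polyb T -> polyb S.
Proof. by move=> ST [c Tc]; exists c => a; apply: leq_trans (Tc a). Qed.

Lemma polyb_const n : polyb (fun _ : A => n).
Proof. by exists n => a; rewrite leq_pmulr // expn_gt0 esize_gt0. Qed.

Lemma polyb_esize : polyb (fun a : A => esize a).
Proof. by exists 1 => a; rewrite mul1n expn1. Qed.

Lemma polyb_add S T : polyb S -> polyb T -> polyb (fun a => S a + T a).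
Proof.
move=> [c Sc] [c' Tc]; exists (c + c') => a; rewrite mulnDl.
apply: leq_add; [apply: leq_trans (Sc a) _|apply: leq_trans (Tc a) _];
  by rewrite leq_mul2l leq_pexp2l ?esize_gt0 ?leq_addr ?leq_addl ?orbT.
Qed.

Lemma polyb_mul S T : polyb S -> polyb T -> polyb (fun a => S a * T a).
Proof.
move=> [c Sc] [c' Tc]; exists (c * c' + (c + c')) => a.
apply: leq_trans (leq_mul (Sc a) (Tc a)) _.
rewrite mulnACA -expnD; apply: leq_mul; first by rewrite leq_addr.
by rewrite leq_pexp2l ?esize_gt0 // leq_addl.
Qed.

Lemma polyb_exp T c : polyb T -> polyb (fun a => T a ^ c).
Proof.
move=> pT; elim: c => [|c IHc]; first exact: polyb_const.
apply: polyb_le (polyb_mul pT IHc) => a; by rewrite expnS.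
Qed.
End Poly.

Lemma polyb_comp A B `{encodable A} `{encodable B} (f : A -> B) (T : B -> nat) :
  polyb T -> polyb (fun a => esize (f a)) -> polyb (fun a => T (f a)).
Proof.
move=> [c Tc] pf; apply: (@polyb_le _ _ _ (fun a => c * esize (f a) ^ c)) => //.
by apply: polyb_mul; [apply: polyb_const|apply: polyb_exp].
Qed.

(** * Polynomial-time functions between encodable types *)

(** Nothing is said about the rest of [p], so that a piece of code works inside every larger
    program. *)
Definition placed (p : program) (o : nat) (q : program) : Prop :=
  forall i, i < size q -> nth ENil p (o + i) = nth ENil q i.

Lemma placed_cat p o q1 q2 :
  placed p o (q1 ++ q2) -> placed p o q1 /\ placed p (o + size q1) q2.
Proof.
move=> pq; split=> i lti.
  by rewrite pq ?nth_cat ?lti // size_cat ltn_addr.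
rewrite -addnA pq; first by rewrite nth_cat ltnNge leq_addr addKn.
by rewrite size_cat ltn_add2l.
Qed.

(* The code is parametric in the address [o] of its auxiliary functions, so
   that programs are linked without renaming calls. *)
Definition ptime A B `{encodable A} `{encodable B} (f : A -> B) : Prop :=
  exists (n : nat) (q : nat -> program) (e : nat -> expr) (T : A -> nat),
    [/\ forall o, size (q o) = n, polyb T
      & forall o p, placed p o (q o) -> forall env a,
          exists2 t, eval p (enc a :: env) (e o) (enc (f a)) t & t <= T a].

Lemma eval_size p env e v t : eval p env e v t -> tree_size v <= t.
Proof. by elim=> *; rewrite ?leqnn ?leq_addl ?leqW // (leq_trans _ (leq_addl _ _)). Qed.

(** Producing a tree costs its size, so the time bound also bounds the output. Composition relies on
    this to feed one polynomial into another. *)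
Lemma ptime_size A B `{encodable A} `{encodable B} (f : A -> B) :
  ptime f -> polyb (fun a => esize (f a)).
Proof.
move=> [n [q [e [T [sq pT ev]]]]]; apply: polyb_le pT => a.
have [i _|t /eval_size H1 ] := ev 0 (q 0) _ [::] a; first by [].
exact: leq_trans.
Qed.

Lemma ptime_ext A B `{encodable A} `{encodable B} (f g : A -> B) :
  f =1 g -> ptime f -> ptime g.
Proof.
move=> fg [n [q [e [T [sq pT ev]]]]]; exists n, q, e, T; split=> // o p pl env a.
by rewrite -fg; apply: ev.
Qed.

(** Programs see codes only. This identifies [nat] with [seq unit], and the pair [(a, s)] with the
    list [a :: s], whose codes coincide. *)
Lemma ptime_recode A A' B B' `{encodable A} `{encodable A'} `{encodable B}
    `{encodable B'} (i : A' -> A) (f : A -> B) (g : A' -> B') :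
  (forall a, enc (i a) = enc a) -> (forall a, enc (f (i a)) = enc (g a)) ->
  ptime f -> ptime g.
Proof.
move=> ei efg [n [q [e [T [sq pT ev]]]]]; exists n, q, e, (T \o i).
split=> // [|o p pl env a]; last by rewrite -ei -efg; apply: ev.
have [c Tc] := pT; exists c => a; apply: leq_trans (Tc _) _.
by rewrite /esize ei.
Qed.

Lemma polytime_ptime (A X Y : Type) `{encodable X} `{encodable Y}
    (dom : A -> Prop) (inp out : A -> tree) (i : A -> X) (f : X -> Y) :
  (forall a, inp a = enc (i a)) -> (forall a, out a = enc (f (i a))) ->
  ptime f -> polytime dom inp out.
Proof.
move=> einp eout [n [q [e [T [sq [c Tc] ev]]]]].
(* The entry expression takes address 0, so its auxiliary functions start at address 1. *)
exists (e 1 :: q 1), c => a _.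
have [j _|t evt tT] := ev 1 (e 1 :: q 1) _ [::] (i a).
  by rewrite add1n.
by exists t; rewrite einp ?eout //; apply: leq_trans tT (Tc _).
Qed.

Section Ptime.
Context {X A B C : Type} {EX : encodable X} {EA : encodable A}.
Context {EB : encodable B} {EC : encodable C}.

Lemma ptime_comp (g : B -> C) (f : A -> B) :
  ptime g -> ptime f -> ptime (fun a => g (f a)).
Proof.
move=> pg pf; have szf := ptime_size pf.
move: pg pf => [ng [qg [eg [Tg [sg pTg evg]]]]] [nf [qf [ef [Tf [sf pTf evf]]]]].
exists (nf + ng), (fun o => qf o ++ qg (o + nf)).
exists (fun o => ELet (ef o) (eg (o + nf))), (fun a => Tf a + Tg (f a) + 1).
split=> [o||o p].
- by rewrite size_cat sf sg.
- by apply: polyb_add (polyb_const _); apply: polyb_add => //; apply: polyb_comp.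
move=> /placed_cat[]; rewrite sf => plf plg env a.
have [tf vf lf] := evf _ _ plf env a.
have [tg vg lg] := evg _ _ plg (enc a :: env) (f a).
by exists (tf + tg).+1; [apply: EvLet vf vg|lia].
Qed.

Lemma ptime_id : ptime (@id A).
Proof.
exists 0, (fun=> [::]), (fun=> EVar 0), (fun a => esize a); split=> //.
  exact: polyb_esize.
by move=> o p _ env a; exists (esize a) => //; apply: (EvVar p (_ :: _) 0).
Qed.

Fixpoint quote (t : tree) : expr :=
  if t is Node l r then ECons (quote l) (quote r) else ENil.

(** The time is the same for all programs and environments, on which the bound in [ptime] must not
    depend. *)
Lemma eval_quote p env t : exists t', eval p env (quote t) t t' /\
  forall p' env' , eval p' env' (quote t) t t'.
Proof.
elim: t => [|l [tl [vl wl]] r [tr [vr wr]]]; first by exists 1; split=> *; apply: EvNil.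
by eexists; split=> * /=; apply: EvCons.
Qed.

Lemma ptime_const (b : B) : ptime (fun _ : A => b).
Proof.
have [t [_ ev]] := eval_quote [::] [::] (enc b).
exists 0, (fun=> [::]), (fun=> quote (enc b)), (fun=> t); split=> //.
  exact: polyb_const.
by move=> o p _ env a; exists t.
Qed.

Lemma ptime_pair (f : A -> B) (g : A -> C) :
  ptime f -> ptime g -> ptime (fun a => (f a, g a)).
Proof.
move=> pf pg; have szf := ptime_size pf; have szg := ptime_size pg.
move: pg pf => [ng [qg [eg [Tg [sg pTg evg]]]]] [nf [qf [ef [Tf [sf pTf evf]]]]].
exists (nf + ng), (fun o => qf o ++ qg (o + nf)).
exists (fun o => ECons (ef o) (eg (o + nf))).
exists (fun a => Tf a + Tg a + (esize (f a) + esize (g a) + 1)).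
split=> [o||o p].
- by rewrite size_cat sf sg.
- by do !(apply: polyb_add => //); apply: polyb_const.
move=> /placed_cat[]; rewrite sf => plf plg env a.
have [tf vf lf] := evf _ _ plf env a.
have [tg vg lg] := evg _ _ plg env a.
by exists (tf + tg + esize (f a, g a)); [apply: EvCons vf vg|rewrite esize_pair; lia].
Qed.

Lemma ptime_if (b : A -> bool) (f g : A -> B) :
  ptime b -> ptime f -> ptime g -> ptime (fun a => if b a then f a else g a).
Proof.
move=> [nb [qb [eb [Tb [sb pTb evb]]]]] [nf [qf [ef [Tf [sf pTf evf]]]]].
move=> [ng [qg [eg [Tg [sg pTg evg]]]]].
exists (nb + (nf + ng)), (fun o => qb o ++ (qf (o + nb) ++ qg (o + nb + nf))).
exists (fun o => EIf (eb o) (ef (o + nb)) (eg (o + nb + nf))).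
exists (fun a => Tb a + (Tf a + Tg a) + 1); split=> [o||o p].
- by rewrite !size_cat sb sf sg.
- by do !(apply: polyb_add => //); apply: polyb_const.
move=> /placed_cat[]; rewrite sb => plb /placed_cat[]; rewrite sf => plf plg env a.
have [tb vb lb] := evb _ _ plb env a.
have [tf vf lf] := evf _ _ plf env a.
have [tg vg lg] := evg _ _ plg env a.
case: (b a) vb => vb.
- by exists (tb + tf).+1; [apply: EvIfTrue vb vf|lia].
- by exists (tb + tg).+1; [apply: EvIfFalse vb vg|lia].
Qed.

End Ptime.

Lemma ptime_prim A B `{encodable A} `{encodable B} (e : expr) (f : A -> B) c :
  (forall p env a, exists2 t, eval p (enc a :: env) e (enc (f a)) t
                            & t <= c * esize a) ->
  ptime f.
Proof.
move=> ev; exists 0, (fun=> [::]), (fun=> e), (fun a => c * esize a); split=> //.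
  by apply: polyb_mul; [apply: polyb_const|apply: polyb_esize].
Qed.

Section Prims.
Context {A B : Type} {EA : encodable A} {EB : encodable B}.

Let var0 p (t : tree) env : eval p (t :: env) (EVar 0) t (tree_size t).
Proof. exact: (EvVar p (t :: env) 0). Qed.

Lemma ptime_fst : ptime (@fst A B).
Proof.
apply: (@ptime_prim _ _ _ _ (EHd (EVar 0)) _ 2) => p env [a b].
eexists; first exact: EvHd (var0 _ _ _).
rewrite esize_pair /= -/(esize a) -/(esize b); lia.
Qed.

Lemma ptime_snd : ptime (@snd A B).
Proof.
apply: (@ptime_prim _ _ _ _ (ETl (EVar 0)) _ 2) => p env [a b].
eexists; first exact: EvTl (var0 _ _ _).
rewrite esize_pair /= -/(esize a) -/(esize b); lia.
Qed.

Lemma ptime_consp : ptime (fun x : A * seq A => x.1 :: x.2).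
Proof. exact: (@ptime_recode _ _ _ _ _ _ _ _ _ _ _ _ _ (ptime_id (A := A * seq A))). Qed.

Lemma ptime_behead0 : ptime (@behead A).
Proof.
apply: (@ptime_prim _ _ _ _ (ETl (EVar 0)) _ 2) => p env a.
have E : enc (behead a) = ttl (enc a) by case: a.
exists (esize a + esize (behead a)).
  by rewrite /esize E; exact: EvTl (var0 _ _ _).
by rewrite mul2n -addnn leq_add2l esize_behead.
Qed.

Lemma ptime_nilp0 : ptime (@nilp A).
Proof.
apply: (@ptime_prim _ _ _ _ (EIf (EVar 0) ENil (ECons ENil ENil)) _ 10) => p env [|a s].
  eexists; first by apply: EvIfFalse; [exact: var0|apply: EvCons; exact: EvNil].
  by [].
eexists; first by apply: EvIfTrue; [exact: var0|exact: EvNil].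
change (is_true ((esize (a :: s) + 1).+1 <= 10 * esize (a :: s))).
have : 0 < esize (a :: s) by exact: esize_gt0.
lia.
Qed.

Lemma ptime_head0 (d : A) : ptime (head d).
Proof.
have [t [_ ev]] := eval_quote [::] [::] (enc d).
apply: (@ptime_prim _ _ _ _ (EIf (EVar 0) (EHd (EVar 0)) (quote (enc d))) _ (t + 3)).
move=> p env [|a s].
  eexists; first by apply: EvIfFalse; [exact: var0|exact: ev].
  by rewrite /esize /=; lia.
eexists; first by apply: EvIfTrue; [exact: var0|exact: (EvHd (var0 p (enc (a :: s)) env))].
change (is_true ((esize (a :: s) + (esize (a :: s) + esize a)).+1
                   <= (t + 3) * esize (a :: s))).
have : esize a < esize (a :: s) by rewrite esize_cons ltnS leq_addr.
by move=> lt; rewrite mulnDl; lia.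
Qed.

End Prims.

Section Ptime2.
Context {X A B : Type} {EX : encodable X} {EA : encodable A} {EB : encodable B}.

Lemma ptime_fst1 (f : X -> A * B) : ptime f -> ptime (fun x => (f x).1).
Proof. exact: ptime_comp ptime_fst. Qed.
Lemma ptime_snd1 (f : X -> A * B) : ptime f -> ptime (fun x => (f x).2).
Proof. exact: ptime_comp ptime_snd. Qed.
Lemma ptime_cons (a : X -> A) s : ptime a -> ptime s -> ptime (fun x => a x :: s x).
Proof. by move=> pa ps; apply: ptime_comp ptime_consp (ptime_pair pa ps). Qed.
Lemma ptime_behead (s : X -> seq A) : ptime s -> ptime (fun x => behead (s x)).
Proof. exact: ptime_comp ptime_behead0. Qed.
Lemma ptime_nilp (s : X -> seq A) : ptime s -> ptime (fun x => nilp (s x)).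
Proof. exact: ptime_comp ptime_nilp0. Qed.
Lemma ptime_head d (s : X -> seq A) : ptime s -> ptime (fun x => head d (s x)).
Proof. exact: ptime_comp (ptime_head0 d). Qed.

(** The one recursive program, from which all loops below are derived. [M] bounds every partial
    result: a step that merely doubled the accumulator would otherwise lead to exponential size. *)
Lemma ptime_foldr (f : X -> B -> A -> A) (a0 : X -> A) (l : X -> seq B)
    (M : X -> nat) :
  ptime (fun y : X * B * A => f y.1.1 y.1.2 y.2) -> ptime a0 -> ptime l ->
  polyb M ->
  (forall x s1 s2, l x = s1 ++ s2 -> esize (foldr (f x) (a0 x) s2) <= M x) ->
  ptime (fun x => foldr (f x) (a0 x) (l x)).
Proof.
move=> pf pa pl pM leM; have szl := ptime_size pl.
move: pf pa pl => [nf [qf [ef [Tf [sf [c Tc] evf]]]]].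
move=> [na [qa [ea [Ta [sa pTa eva]]]]] [nl [ql [el [Tl [sl pTl evl]]]]].
(* A called function sees its argument only, so the list still to be folded travels in a pair with
   [x]. The address [o] is that of [body] itself. *)
pose body o := EIf (EHd (EVar 0))
  (ELet (ECons (ECons (ETl (EVar 0)) (EHd (EHd (EVar 0))))
               (ECall o (ECons (ETl (EHd (EVar 0))) (ETl (EVar 0)))))
        (ef (o + 1)))
  (ELet (ETl (EVar 0)) (ea (o + 1 + nf))).
exists (1 + (nf + (na + nl))).
exists (fun o => [:: body o] ++ (qf (o + 1) ++ (qa (o + 1 + nf) ++ ql (o + 1 + nf + na)))).
exists (fun o => ECall o (ECons (el (o + 1 + nf + na)) (EVar 0))).
(* [L x] bounds the size of every argument given to [f], and also the number of rounds; [step x]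
   bounds the cost of one round. *)
pose (L := fun x : X => esize (l x) + esize x + M x + 5).
pose step x := c * L x ^ c + 20 * L x + Ta x + 20.
exists (fun x : X => Tl x + (2 * esize x + esize (l x) + 10) + L x * step x).
have pL : polyb L.
  by do !apply: polyb_add => //; [exact: polyb_esize|exact: polyb_const].
split=> [o||o p].
- by rewrite !size_cat sf sa sl.
- apply: polyb_add; last first.
    apply: polyb_mul => //; apply: polyb_add; last exact: polyb_const.
    apply: polyb_add => //; apply: polyb_add.
      by apply: polyb_mul; [exact: polyb_const|exact: polyb_exp].
    by apply: polyb_mul => //; exact: polyb_const.
  apply: polyb_add => //; apply: polyb_add; last exact: polyb_const.
  apply: polyb_add => //.
  by apply: polyb_mul; [exact: polyb_const|exact: polyb_esize].
move=> /placed_cat[plb] /placed_cat[]; rewrite /= sf => plf /placed_cat[].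
rewrite sa => pla pll env x.
have bodyE : nth ENil p o = body o by have := plb 0; rewrite addn0; apply.
have main s1 s2 : l x = s1 ++ s2 -> exists2 t,
    eval p [:: Node (enc s2) (enc x)] (body o) (enc (foldr (f x) (a0 x) s2)) t
    & t <= (size s2).+1 * step x.
  have var0 t e : eval p (t :: e) (EVar 0) t (tree_size t) by exact: (EvVar p (t :: e) 0).
  elim: s2 s1 => [|b s2 IHs] s1 ls.
    have [ta va lta] := eva _ _ pla [:: Node (enc ([::] : seq B)) (enc x)] x.
    eexists.
      apply: EvIfFalse; first exact: (EvHd (var0 _ _)).
      apply: EvLet; [exact: (EvTl (var0 _ _))|exact: va].
    rewrite /= -/(esize x) /step /L; lia.
  have ls' : l x = rcons s1 b ++ s2 by rewrite cat_rcons.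
  have [t vt lt] := IHs _ ls'.
  set r := foldr (f x) (a0 x) s2 in vt *.
  have [tf vf ltf] := evf _ _ plf [:: Node (enc (b :: s2)) (enc x)] (x, b, r).
  have sl2 : esize (b :: s2) <= esize (l x).
    by rewrite ls esize_catr.
  have rM : esize r <= M x by apply: leM ls'.
  rewrite esize_cons in sl2.
  have ltf' : tf <= c * L x ^ c.
    apply: leq_trans ltf (leq_trans (Tc _) _); rewrite leq_mul2l; apply/orP; right.
    by apply: leq_expl => //; rewrite !esize_pair /L; lia.
  eexists.
    apply: EvIfTrue; first exact: (EvHd (var0 _ _)).
    apply: EvLet.
      apply: EvCons.
        apply: EvCons; first exact: (EvTl (var0 _ _)).
        exact: (EvHd (EvHd (var0 _ _))).
      apply: EvCall.
        apply: EvCons; [exact: (EvTl (EvHd (var0 _ _)))|exact: (EvTl (var0 _ _))].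
      by rewrite bodyE; exact: vt.
    exact: vf.
  rewrite [size _]/= [(size s2).+2 * _]mulSn.
  apply: leq_trans (leq_add (leqnn _) lt).
  move: ltf' sl2 rM; rewrite /step; set P := c * _ ^ _; rewrite /L /esize /=.
  change (tlist [seq enc i | i <- s2]) with (enc s2);
  move: (tree_size (enc b)) (tree_size (enc s2)) (tree_size (enc x)).
  by move: (tree_size (enc r)) (tree_size (enc (l x))) => *; lia.
have [t vt lt] := main [::] (l x) erefl.
have [tl vl ltl] := evl _ _ pll env x.
eexists.
  apply: EvCall.
    apply: EvCons; first exact: vl.
    exact: (EvVar p (enc x :: env) 0).
  by rewrite bodyE; exact: vt.
have sL : (size (l x)).+1 * step x <= L x * step x.
  rewrite leq_mul2r; apply/orP; right; rewrite /L -!addnA ltn_addr //.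
  exact: size_esize.
apply: leq_trans (leq_add (leq_add ltl (leqnn _)) (leq_trans lt sL)).
rewrite /esize /=; lia.
Qed.

End Ptime2.

(** * List functions *)

Section Lists.
Context {X A B : Type} {EX : encodable X} {EA : encodable A} {EB : encodable B}.

Lemma ptime_cat (s1 s2 : X -> seq A) :
  ptime s1 -> ptime s2 -> ptime (fun x => s1 x ++ s2 x).
Proof.
move=> p1 p2; apply: (@ptime_ext _ _ _ _ (fun x => foldr cons (s2 x) (s1 x))).
  by move=> x; rewrite -[RHS]/(_ ++ _); elim: (s1 x) => //= a s ->.
apply: (@ptime_foldr _ _ _ _ _ _ (fun=> cons) s2 s1
  (fun x => esize (s1 x) + esize (s2 x))) => //.
- by apply: ptime_cons;
    [apply: ptime_snd1; apply: ptime_fst|apply: ptime_snd].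
- by apply: polyb_add; apply: ptime_size.
move=> x r1 r2 ->; have -> : foldr cons (s2 x) r2 = r2 ++ s2 x by elim: r2 => //= a s ->.
rewrite (leq_trans (esize_cat _ _)) // leq_add2r; exact: esize_catr.
Qed.

Lemma ptime_map (f : X -> A -> B) (l : X -> seq A) :
  ptime (fun y : X * A => f y.1 y.2) -> ptime l ->
  ptime (fun x => map (f x) (l x)).
Proof.
move=> pf pl; have [c Mc] := ptime_size pf; have szl := ptime_size pl.
apply: (@ptime_foldr _ _ _ _ _ _ (fun x a r => f x a :: r) (fun=> [::]) l
  (fun x => esize (l x) * (c * (esize x + esize (l x) + 1) ^ c + 2))) => //.
- apply: ptime_cons; last exact: ptime_snd.
  exact: (ptime_comp (g := fun y : X * A => f y.1 y.2)) pf ptime_fst.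
- exact: ptime_const.
- apply: polyb_mul => //; apply: polyb_add; last exact: polyb_const.
  apply: polyb_mul; first exact: polyb_const.
  apply: polyb_exp; apply: polyb_add; last exact: polyb_const.
  by apply: polyb_add => //; apply: polyb_esize.
move=> x s1 s2 lx; set m := c * _ ^ _.
have fm a : esize a < esize (l x) -> esize (f x a) <= m.
  move=> lea; apply: leq_trans (Mc (x, a)) _; rewrite leq_mul2l leq_expl ?orbT //.
  by rewrite esize_pair; lia.
have le2 : esize s2 <= esize (l x) by rewrite lx esize_catr.
apply: (@leq_trans (esize s2 * (m + 2))); last by rewrite leq_mul2r le2 orbT.
elim: s2 le2 {lx} => [|a s2 IHs]; first by rewrite mulnDr /esize /=; lia.
rewrite esize_cons => les /=; rewrite esize_cons.
have {}IHs := IHs (leq_trans (leq_trans (leq_addl _ _) (leqnSn _)) les).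
have {}fm := fm a (leq_ltn_trans (leq_addr _ _) les).
by move: IHs fm; rewrite mulSn mulnDl; set P := esize s2 * _; lia.
Qed.

Lemma ptime_iter (f : X -> A -> A) (n : X -> nat) (a0 : X -> A) (M : X -> nat) :
  ptime (fun y : X * A => f y.1 y.2) -> ptime n -> ptime a0 -> polyb M ->
  (forall x i, i <= n x -> esize (iter i (f x) (a0 x)) <= M x) ->
  ptime (fun x => iter (n x) (f x) (a0 x)).
Proof.
move=> pf pn pa pM leM.
have foldE x k : foldr (fun _ : unit => f x) (a0 x) (nseq k tt) = iter k (f x) (a0 x).
  by elim: k => //= k ->.
apply: (@ptime_ext _ _ _ _ (fun x => foldr (fun _ : unit => f x) (a0 x) (nseq (n x) tt))).
  by move=> x; apply: foldE.
apply: (@ptime_foldr _ _ _ _ _ _ (fun x _ => f x) a0 _ M) => //.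
- apply: (ptime_comp (g := fun y : X * A => f y.1 y.2)
    (f := fun y : X * unit * A => (y.1.1, y.2))) pf _.
  apply: ptime_pair; last exact: ptime_snd.
  by apply: ptime_fst1; apply: ptime_fst.
- apply: (@ptime_recode X X nat (seq unit) _ _ _ _ id n _ _ _ pn) => // x.
  by elim: (n x) => //= k IHk; congr (Node Leaf _).
move=> x s1 s2 E.
have -> : s2 = nseq (size s2) tt by elim: (s2) => //= -[] s <-.
by rewrite foldE leM // -[n x](size_nseq _ tt) E size_cat leq_addl.
Qed.

Lemma ptime_has (f : X -> A -> bool) (l : X -> seq A) :
  ptime (fun y : X * A => f y.1 y.2) -> ptime l ->
  ptime (fun x => has (f x) (l x)).
Proof.
move=> pf pl.
apply: (@ptime_ext _ _ _ _ (fun x => foldr (fun a b => if f x a then true else b) false (l x))).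
  by move=> x; elim: (l x).
apply: (@ptime_foldr _ _ _ _ _ _ (fun x a b => if f x a then true else b) _ _ (fun=> 3)) => //.
- apply: ptime_if; last exact: ptime_snd.
    exact: (ptime_comp (g := fun y : X * A => f y.1 y.2)) pf ptime_fst.
  exact: ptime_const.
- exact: ptime_const.
- exact: polyb_const.
by move=> x s1 s2 _; apply: esize_bool.
Qed.

End Lists.

Lemma esize_filter A `{encodable A} (f : pred A) s : esize (filter f s) <= esize s.
Proof.
elim: s => //= a s IHs; case: ifP => _; rewrite !esize_cons ?ltnS ?leq_add2l //.
by rewrite (leq_trans IHs) // ltnW // ltnS leq_addl.
Qed.

Section Lists2.
Context {X A : Type} {EX : encodable X} {EA : encodable A}.
Implicit Types (l : X -> seq A).

Lemma ptime_filter (f : X -> A -> bool) l :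
  ptime (fun y : X * A => f y.1 y.2) -> ptime l ->
  ptime (fun x => filter (f x) (l x)).
Proof.
move=> pf pl.
apply: (@ptime_foldr _ _ _ _ _ _ (fun x a r => if f x a then a :: r else r)
  _ _ (fun x => esize (l x))) => //.
- apply: ptime_if; last exact: ptime_snd.
    exact: (ptime_comp (g := fun y : X * A => f y.1 y.2)) pf ptime_fst.
  apply: ptime_cons; last exact: ptime_snd.
  by apply: ptime_snd1; apply: ptime_fst.
- exact: ptime_const.
- exact: ptime_size.
by move=> x s1 s2 ->; apply: leq_trans (esize_filter _ _) (esize_catr _ _).
Qed.

Lemma ptime_negb (b : X -> bool) : ptime b -> ptime (fun x => ~~ b x).
Proof. by move=> pb; apply: ptime_if => //; apply: ptime_const. Qed.

Lemma ptime_andb (b c : X -> bool) : ptime b -> ptime c -> ptime (fun x => b x && c x).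
Proof. by move=> pb pc; apply: ptime_if => //; apply: ptime_const. Qed.

Lemma ptime_orb (b c : X -> bool) : ptime b -> ptime c -> ptime (fun x => b x || c x).
Proof. by move=> pb pc; apply: ptime_if => //; apply: ptime_const. Qed.

Lemma ptime_eqb (b c : X -> bool) : ptime b -> ptime c -> ptime (fun x => b x == c x).
Proof.
move=> pb pc; apply: (@ptime_ext _ _ _ _ (fun x => if b x then c x else ~~ c x)).
  by move=> x; case: (b x) (c x) => [] [].
by apply: ptime_if => //; apply: ptime_negb.
Qed.

End Lists2.

Section Lists3.
Context {X A : Type} {EX : encodable X} {EA : encodable A}.
Implicit Types (l : X -> seq A).

Lemma ptime_all (f : X -> A -> bool) l :
  ptime (fun y : X * A => f y.1 y.2) -> ptime l ->
  ptime (fun x => all (f x) (l x)).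
Proof.
move=> pf pl; apply: (@ptime_ext _ _ _ _ (fun x => ~~ has (fun a => ~~ f x a) (l x))).
  by move=> x; rewrite -all_predC; apply: eq_all => a; apply: negbK.
by apply/ptime_negb/(@ptime_has _ _ _ _ (fun x a => ~~ f x a)) => //; apply: ptime_negb.
Qed.

Lemma ptime_flatten (l : X -> seq (seq A)) : ptime l -> ptime (fun x => flatten (l x)).
Proof.
move=> pl.
apply: (@ptime_foldr _ _ _ _ _ _ (fun x => cat) _ _ (fun x => esize (l x))) => //.
- by apply: ptime_cat; [apply: ptime_snd1; apply: ptime_fst|apply: ptime_snd].
- exact: ptime_const.
- exact: ptime_size.
move=> x s1 s2 ->; apply: leq_trans (esize_catr _ _).
elim: s2 => //= a s IHs; rewrite esize_cons (leq_trans (esize_cat _ _)) //.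
by rewrite ltnW // ltnS leq_add2l.
Qed.

End Lists3.

(** * Unary arithmetic *)

Section Lists4.
Context {X A : Type} {EX : encodable X} {EA : encodable A}.
Implicit Types (l : X -> seq A).

Lemma ptime_succ (n : X -> nat) : ptime n -> ptime (fun x => (n x).+1).
Proof.
move=> pn; apply: (@ptime_recode X X (unit * nat) nat _ _ _ _ id (fun x => (tt, n x))) => //.
by apply: ptime_pair => //; apply: ptime_const.
Qed.

Lemma ptime_units (n : X -> nat) : ptime n -> ptime (fun x => nseq (n x) tt).
Proof.
move=> pn; apply: (@ptime_recode X X nat (seq unit) _ _ _ _ id n _ _ _ pn) => // x.
by elim: (n x) => //= k IHk; congr (Node Leaf _).
Qed.

Lemma ptime_of_units (n : X -> seq unit) : ptime n -> ptime (fun x => size (n x)).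
Proof.
move=> pn; apply: (@ptime_recode X X (seq unit) nat _ _ _ _ id n _ _ _ pn) => // x.
by elim: (n x) => //= -[] s IHs; congr (Node Leaf _).
Qed.

Lemma ptime_pred (n : X -> nat) : ptime n -> ptime (fun x => (n x).-1).
Proof.
move=> pn; apply: (@ptime_ext _ _ _ _ (fun x => size (behead (nseq (n x) tt)))).
  by move=> x; rewrite size_behead size_nseq.
by apply/ptime_of_units/ptime_behead/ptime_units.
Qed.

Lemma ptime_eq0 (n : X -> nat) : ptime n -> ptime (fun x => n x == 0).
Proof.
move=> pn; apply: (@ptime_ext _ _ _ _ (fun x => nilp (nseq (n x) tt))).
  by move=> x; rewrite /nilp size_nseq.
by apply/ptime_nilp/ptime_units.
Qed.

End Lists4.

Section Lists5.
Context {X A : Type} {EX : encodable X} {EA : encodable A}.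
Implicit Types (l : X -> seq A).

Lemma ptime_sizes l : ptime l -> ptime (fun x => size (l x)).
Proof.
move=> pl; apply: (@ptime_ext _ _ _ _ (fun x => size (map (fun=> tt) (l x)))).
  by move=> x; rewrite size_map.
by apply: ptime_of_units; apply: (ptime_map (f := fun _ _ => tt)) => //; apply: ptime_const.
Qed.

End Lists5.

Section Lists6.
Context {X A : Type} {EX : encodable X} {EA : encodable A}.
Implicit Types (l : X -> seq A).

Lemma ptime_subn (m n : X -> nat) : ptime m -> ptime n -> ptime (fun x => m x - n x).
Proof.
move=> pm pn; have E k i : iter i predn k = k - i by elim: i => [|i IHi] /=; rewrite ?subn0 ?IHi ?subnS.
apply: (@ptime_ext _ _ _ _ (fun x => iter (n x) predn (m x))) => [x|]; first exact: E.
apply: (@ptime_iter _ _ _ _ (fun=> predn) _ _ (fun x => esize (m x))) => //.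
- by apply: ptime_pred; apply: ptime_snd.
- exact: ptime_size.
by move=> x i _; rewrite E !esize_nat; lia.
Qed.

End Lists6.

Section Lists7.
Context {X A : Type} {EX : encodable X} {EA : encodable A}.
Implicit Types (l : X -> seq A).

Lemma ptime_leq (m n : X -> nat) : ptime m -> ptime n -> ptime (fun x => m x <= n x).
Proof. by move=> pm pn; apply/ptime_eq0/ptime_subn. Qed.

Lemma ptime_eqn (m n : X -> nat) : ptime m -> ptime n -> ptime (fun x => m x == n x).
Proof.
move=> pm pn; apply: (@ptime_ext _ _ _ _ (fun x => (m x <= n x) && (n x <= m x))).
  by move=> x; rewrite eqn_leq.
by apply: ptime_andb; apply: ptime_leq.
Qed.

Lemma ptime_muln (m n : X -> nat) : ptime m -> ptime n -> ptime (fun x => m x * n x).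
Proof.
move=> pm pn.
apply: (@ptime_ext _ _ _ _ (fun x => size (flatten (map (fun=> nseq (n x) tt) (nseq (m x) tt))))).
  by move=> x; elim: (m x) => //= k; rewrite size_cat size_nseq mulSn => ->.
apply/ptime_of_units/ptime_flatten.
apply: (ptime_map (f := fun x _ => nseq (n x) tt)); last exact: ptime_units.
by apply: ptime_units; apply: ptime_comp pn ptime_fst.
Qed.

Lemma ptime_drop (n : X -> nat) l : ptime n -> ptime l -> ptime (fun x => drop (n x) (l x)).
Proof.
move=> pn pl; have E i (s : seq A) : iter i behead s = drop i s.
  by elim: i s => [|i IHi] s; rewrite ?drop0 // iterSr IHi; case: s.
apply: (@ptime_ext _ _ _ _ (fun x => iter (n x) behead (l x))) => [x|]; first exact: E.
apply: (@ptime_iter _ _ _ _ (fun=> behead) _ _ (fun x => esize (l x))) => //.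
- by apply: ptime_behead; apply: ptime_snd.
- exact: ptime_size.
by move=> x i _; rewrite E -{2}[l x](cat_take_drop i) esize_catr.
Qed.

Lemma ptime_nth d (n : X -> nat) l : ptime n -> ptime l -> ptime (fun x => nth d (l x) (n x)).
Proof.
move=> pn pl; apply: (@ptime_ext _ _ _ _ (fun x => head d (drop (n x) (l x)))).
  by move=> x; rewrite -nth0 nth_drop addn0.
exact/ptime_head/ptime_drop.
Qed.

End Lists7.

Section Lists8.
Context {X A : Type} {EX : encodable X} {EA : encodable A}.
Implicit Types (l : X -> seq A).

Lemma ptime_iota0 (n : X -> nat) : ptime n -> ptime (fun x => iota 0 (n x)).
Proof.
move=> pn; have E i : iter i (fun s => 0 :: map S s) [::] = iota 0 i.
  by elim: i => //= i ->; rewrite -[1]/(1 + 0) iotaDl.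
apply: (@ptime_ext _ _ _ _ (fun x => iter (n x) (fun s => 0 :: map S s) [::])) => [x|]; first exact: E.
apply: (@ptime_iter _ _ _ _ (fun _ s => 0 :: map S s) _ _
  (fun x => esize (n x) * (esize (n x)).+1)) => //.
- apply: ptime_cons; first exact: ptime_const.
  apply: (ptime_map (f := fun _ => S)); last exact: ptime_snd.
  by apply: ptime_succ; apply: ptime_snd.
- exact: ptime_const.
- apply: polyb_mul; first exact: ptime_size.
  apply: (@polyb_le _ _ _ (fun x => esize (n x) + 1)); first by move=> x; rewrite addn1.
  by apply: polyb_add; [exact: ptime_size|exact: polyb_const].
move=> x i lei; rewrite E.
have H k : k <= n x -> esize (iota 0 k) <= (esize (n x)).+1 * k + 1.
  elim: k => [|k IHk] lek; first by rewrite muln0.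
  rewrite -addn1 iotaD add0n (leq_trans (esize_cat _ _)) //.
  have -> : esize (iota k 1) = k.*2.+3 by rewrite esize_cons esize_nat /esize /=; lia.
  have := IHk (ltnW lek); rewrite mulnDr muln1 esize_nat.
  by set e := esize _; set m := _ * k; lia.
apply: leq_trans (H _ lei) _; rewrite esize_nat; nia.
Qed.

End Lists8.

Section Lists9.
Context {X A : Type} {EX : encodable X} {EA : encodable A}.
Implicit Types (l : X -> seq A).

Lemma ptime_mem (u : X -> nat) (s : X -> seq nat) :
  ptime u -> ptime s -> ptime (fun x => u x \in s x).
Proof.
move=> pu ps; apply: (@ptime_ext _ _ _ _ (fun x => has (fun v => v == u x) (s x))).
  by move=> x; rewrite -has_pred1.
apply: (ptime_has (f := fun x v => v == u x)) => //; apply: ptime_eqn.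
  exact: ptime_snd.
exact: ptime_comp pu ptime_fst.
Qed.

End Lists9.

(** * The reduction on lists of vertices *)

Section Algorithm.
Variables (nb : rel nat) (vs : seq nat).
Implicit Types (k t u v w x z : nat) (p q D S W Z : seq nat).

Definition narrow k x W :=
  let W' := [seq z <- W | nb x z] in
  if (size W' < size W) && ((size W).-1 <= k * size W') then W' else W.

Definition pass k W := foldr (narrow k) W vs.

Definition descend k Z := iter (size Z) (pass k) Z.

Definition shrink k Z :=
  let W := descend k Z in
  if 1 < size W then [seq z <- Z | z != head 0 W] else Z.

Definition core k := iter (size vs) (shrink k) vs.

Fixpoint linked p :=
  if p is v :: q then (nilp q || has (nb v) q) && linked q else true.

(* Lists grow at the head: each vertex is adjacent to a later one, or repeats it. *)
Definition extend (L : seq (seq nat)) :=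
  flatten [seq [seq v :: p | v <- vs & nilp p || has (nb v) p] | p <- L].

Definition links t := iter t extend [:: [::]].

Definition twin Z v w := all (fun z => nb v z == nb w z) Z.

Definition twins Z t p q :=
  all (fun i => twin Z (nth 0 p i) (nth 0 q i)) (iota 0 t).

Definition reps Z t (L : seq (seq nat)) :=
  foldr (fun p acc => if has (twins Z t p) acc then acc else p :: acc) [::] L.

Definition kept t k := core k ++ flatten (reps (core k) t (links t)).

(** Filtering [vs] removes the repetitions in [kept], so that positions in this list can serve as
    vertices of the kernel graph. *)
Definition kernel t k := [seq v <- vs | v \in kept t k].

(** A round of breadth-first search. The result is a sublist of [S], which bounds its size, and for
    reflexive [nb] nothing already reached is lost. *)
Definition grow S R := [seq v <- S | has (nb v) R].

Definition connb S :=
  let R := iter (size S) (grow S) [seq v <- S | v == head 0 S] in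
  all (fun v => v \in R) S.

Definition cdsb D := all (fun v => has (nb v) D) vs && connb D.

End Algorithm.

(** * Fibres and numbers of lists *)

Section Counting.
Context {T : eqType}.

Lemma size_fibers (T' : eqType) (h : T -> T') (s : seq T) (C : seq T') m :
  {in s, forall x, h x \in C} ->
  {in C, forall c, count (fun x => h x == c) s <= m} -> size s <= m * size C.
Proof.
elim: C s => [|c C IHC] s hC le; first by case: s hC le => // x s /(_ x (mem_head _ _)).
rewrite mulnS -(count_predC (fun x => h x == c)); apply: leq_add; first exact/le/mem_head.
rewrite -size_filter; apply: IHC => [x|c' c'C].
  by rewrite mem_filter => /andP[/= /negPf ne /hC]; rewrite inE ne.
apply: leq_trans (le c' _); last by rewrite inE c'C orbT.
by rewrite count_filter; apply: sub_count => x /andP[].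
Qed.

Fixpoint lists_upto n (s : seq T) : seq (seq T) :=
  if n is n'.+1 then [::] :: [seq x :: p | x <- s, p <- lists_upto n' s]
  else [:: [::]].

Lemma size_lists_upto n s : size (lists_upto n s) <= (size s).+1 ^ n.
Proof.
elim: n => //= n IHn; rewrite size_allpairs expnS mulSn.
by rewrite -add1n leq_add ?expn_gt0 // leq_mul2l IHn orbT.
Qed.

Lemma mem_lists_upto n s p :
  size p <= n -> {subset p <= s} -> p \in lists_upto n s.
Proof.
elim: n p => [|n IHn] [|x p] //= lep ps; rewrite inE /=; apply/allpairsP.
exists (x, p); split=> //=; first by apply: ps; rewrite mem_head.
by apply: IHn => // y yp; apply: ps; rewrite inE yp orbT.
Qed.

End Counting.

(** * The domination core *)

Section DominationCore.
Variables (nb : rel nat) (vs : seq nat).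
Hypotheses (nbC : symmetric nb) (nbxx : reflexive nb) (uvs : uniq vs).
Implicit Types (k t u v w x z : nat) (p q D S W Z : seq nat).

Definition dominated (V D : seq nat) := {in V, forall v, has (nb v) D}.

Definition is_core k Z := forall D,
  {subset D <= vs} -> size D <= k -> dominated Z D -> dominated vs D.

Definition stuck k W := {in vs, forall x, narrow nb k x W = W}.

Lemma narrow_sub k x W : subseq (narrow nb k x W) W.
Proof. by rewrite /narrow; case: ifP => // _; apply: filter_subseq. Qed.

Lemma pass_sub k s W : subseq (foldr (narrow nb k) W s) W.
Proof. by elim: s => //= x s; apply: subseq_trans (narrow_sub _ _ _). Qed.

Lemma descend_sub k Z : subseq (descend nb vs k Z) Z.
Proof.
by rewrite /descend; elim: (size Z) => //= i; apply/subseq_trans/pass_sub.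
Qed.

Lemma narrow_size k x W :
  size (narrow nb k x W) = size W -> narrow nb k x W = W.
Proof. by rewrite /narrow; case: ifP => // /andP[lt _] E; rewrite E ltnn in lt. Qed.

Lemma pass_fix k s W : size (foldr (narrow nb k) W s) = size W ->
  {in s, forall x, narrow nb k x W = W}.
Proof.
elim: s => //= x s IHs E.
have le1 := size_subseq (narrow_sub k x (foldr (narrow nb k) W s)).
have le2 := size_subseq (pass_sub k s W).
have E2 : size (foldr (narrow nb k) W s) = size W.
  by apply/eqP; rewrite eqn_leq le2 -E le1.
have eW : foldr (narrow nb k) W s = W.
  by apply/eqP; rewrite -(size_subseq_leqif (pass_sub k s W)) E2.
rewrite eW in E; move=> y; rewrite inE => /predU1P[->|]; last exact: IHs.
exact: narrow_size.
Qed.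

(** A pass that keeps the size consists of narrowings that all change nothing; any other pass loses
    an element. So [size Z] passes suffice, the empty list being stuck. *)
Lemma stuck_descend k Z : stuck k (descend nb vs k Z).
Proof.
have H i : stuck k (iter i (pass nb vs k) Z) \/
    size (iter i (pass nb vs k) Z) <= size Z - i.
  elim: i => [|i]; first by right; rewrite subn0.
  rewrite iterS; set W := iter i _ _; case=> IHi.
    left; rewrite (_ : pass _ _ _ _ = W) //.
    rewrite /pass; move: IHi; rewrite /stuck; elim: (vs) => //= x s IHs st.
    by rewrite IHs => [|y ys]; apply: st; rewrite inE ?eqxx ?ys ?orbT.
  have := size_subseq (pass_sub k vs W); rewrite leq_eqVlt => /predU1P[/[dup] E /pass_fix st|lt].
    left; rewrite (_ : pass _ _ _ _ = W) //.
    by apply/eqP; rewrite -(size_subseq_leqif (pass_sub k vs W)) E.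
  by right; have := leq_trans lt IHi; rewrite subnS; case: (size Z - i).
have [//|] := H (size Z); rewrite subnn leqn0 => /nilP E.
by rewrite /descend E => x _; rewrite /narrow /=.
Qed.

Lemma sum_cover V D : dominated V D ->
  size V <= sumn [seq size [seq z <- V | nb x z] | x <- D].
Proof.
elim: D V => [|x D IHD] V dom; first by case: V dom => // v V /(_ v (mem_head _ _)).
rewrite -(count_predC (nb x) V) -size_filter /= leq_add2l -size_filter.
apply: leq_trans (IHD _ _) _ => [v|].
  rewrite mem_filter => /andP[/= nxv /dom] /=; by rewrite nbC (negPf nxv).
elim: {IHD dom} D => //= y D IHD; apply: leq_add => //.
by rewrite -filter_predI !size_filter; apply: sub_count => z /= /andP[].
Qed.

Lemma shrink_core k Z : uniq Z -> {subset Z <= vs} ->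
  is_core k Z -> is_core k (shrink nb vs k Z).
Proof.
rewrite /shrink; set W := descend _ _ _ _ => uZ Zvs; case: ifP => // lt1.
have sW : subseq W Z by apply: descend_sub.
have uW := subseq_uniq sW uZ.
have stW : stuck k W by apply: stuck_descend.
have: head 0 W \in W by case: (W) lt1 => // *; apply: mem_head.
move: (head 0 W) => z zW coreZ D Dvs leD dom; apply: coreZ => // y yZ.
have [->{y yZ}|ny] := eqVneq y z; last by apply: dom; rewrite mem_filter ny.
apply: contraT => ndom.
(* No vertex of [D] is near [z], so narrowing by it would be proper; as [W] is stuck, the size
   condition must fail. At most [k] such vertices cover at most |W| - 2 elements of [W], one short
   of the |W| - 1 other than [z]. *)
have lt x : x \in D -> k * size [seq z <- W | nb x z] <= (size W).-2.
  move=> xD; have := stW x (Dvs _ xD); rewrite /narrow.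
  have lt' : size [seq z <- W | nb x z] < size W.
    rewrite ltn_neqAle size_subseq ?filter_subseq // andbT size_filter -all_count.
    apply: contra ndom => /allP/(_ _ zW) nxz; apply/hasP; exists x => //.
    by rewrite nbC.
  rewrite lt' /=; case: leqP => [_ E|]; last by lia.
  by rewrite E ltnn in lt'.
have cov : dominated [seq y <- W | y != z] D.
  move=> y; rewrite mem_filter => /andP[ny yW].
  by apply: dom; rewrite mem_filter ny (mem_subseq sW).
have := sum_cover cov; have -> : size [seq y <- W | y != z] = (size W).-1 by rewrite -rem_filter // size_rem.
rewrite leqNgt => /negP[].
set f := fun x => size _; have sumk : k * sumn (map f D) <= size D * (size W).-2.
  elim: (D) lt => [|x E IHE] lt /=; first by rewrite muln0.
  rewrite mulnDr mulSn leq_add //; last by apply: IHE => y yE; rewrite lt ?inE ?yE ?orbT.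
  apply: leq_trans (lt _ (mem_head _ _)); rewrite leq_mul2l; apply/orP; right.
  apply: size_subseq; rewrite -filter_predI; under eq_filter do rewrite /= andbC.
  by rewrite filter_predI; apply: filter_subseq.
have [/size0nil->|D0] := posnP (size D); first by rewrite /= -subn1 subn_gt0.
have k0 : 0 < k by apply: leq_trans leD.
have : k * sumn (map f D) <= k * (size W).-2.
  by apply: leq_trans sumk _; rewrite leq_mul2r leD orbT.
by rewrite leq_pmul2l //; lia.
Qed.

Lemma shrink_sub k Z : subseq (shrink nb vs k Z) Z.
Proof. by rewrite /shrink; case: ifP => // _; apply: filter_subseq. Qed.

Lemma core_sub k : subseq (core nb vs k) vs.
Proof. by rewrite /core; elim: (size vs) => //= i; apply/subseq_trans/shrink_sub. Qed.

Lemma core_core k : is_core k (core nb vs k).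
Proof.
suff: subseq (core nb vs k) vs /\ is_core k (core nb vs k) by case.
rewrite /core; elim: {1 2}(size vs) => [|i]; first by split=> // D.
rewrite iterS; set Z := iter _ _ _ => -[sZ cZ]; split.
  exact: subseq_trans (shrink_sub _ _) sZ.
by apply: shrink_core => //; [apply: subseq_uniq uvs|apply: mem_subseq].
Qed.

(** A round that finds a longer [W] drops a vertex, and there are as many rounds as vertices. *)
Lemma size_descend_core k : size (descend nb vs k (core nb vs k)) <= 1.
Proof.
suff H i : size (descend nb vs k (iter i (shrink nb vs k) vs)) <= 1 \/
    size (iter i (shrink nb vs k) vs) <= size vs - i.
  have [//|] := H (size vs); rewrite subnn leqn0 => /nilP E.
  by rewrite /core E.
elim: i => [|i]; first by right; rewrite subn0.
rewrite iterS; set Z := iter _ _ _; rewrite /shrink; case: ltnP => [lt1 IHi|le1 _]; last by left.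
right; have {}IHi : size Z <= size vs - i by case: IHi => //; rewrite leqNgt lt1.
have hZ : head 0 (descend nb vs k Z) \in Z.
  by apply: (mem_subseq (descend_sub k Z)); case: (descend _ _ _ _) lt1 => // *; apply: mem_head.
rewrite subnS; have lt : size [seq z <- Z | z != head 0 (descend nb vs k Z)] < size Z.
  rewrite size_filter ltn_neqAle count_size andbT -all_count.
  by apply/negP => /allP/(_ _ hZ); rewrite eqxx.
by have := leq_trans lt IHi; case: (size vs - i).
Qed.

(** Between disjoint lists the reflexive [nb] is plain adjacency, so this is the absence of a
    biclique subgraph. *)
Definition biclique_free_on d := forall p q, uniq p -> uniq q ->
  {subset p <= vs} -> {subset q <= vs} -> size p = d -> size q = d ->
  ~~ has (mem p) q -> ~~ all (fun v => all (nb v) q) p.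

Lemma mem_links t p : (p \in links nb vs t) =
  [&& size p == t, all (mem vs) p & linked nb p].
Proof.
elim: t p => [|t IHt] p; first by rewrite inE; case: p.
rewrite /links iterS -/(links nb vs t); apply/flatten_mapP/idP.
  case=> q; rewrite IHt => /and3P[/eqP <- qvs lq] /mapP[v].
  by rewrite mem_filter => /andP[nv vvs] ->; rewrite /= eqxx vvs qvs nv.
case: p => [|v p] //=; rewrite eqSS => /andP[szp /andP[/andP[vvs pvs] /andP[nv lp]]].
exists p; first by rewrite IHt szp pvs.
by apply/mapP; exists v; rewrite // mem_filter nv.
Qed.

(** * Twins and their representatives *)

Section Reps.
Variables (Z : seq nat) (t : nat).

(** A canonical name for the twin class of [v], which turns twin classes into lists that can be
    counted. *)
Definition trace v := [seq z <- Z | nb v z].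

Lemma twinP v w : reflect (trace v = trace w) (twin nb Z v w).
Proof.
apply: (iffP allP) => [H|E z zZ].
  by apply: eq_in_filter => z /H /eqP.
apply/eqP; have: (z \in trace v) = (z \in trace w) by rewrite E.
by rewrite !mem_filter zZ !andbT.
Qed.

Lemma twinsP p q : size p = t -> size q = t ->
  reflect (map trace p = map trace q) (twins nb Z t p q).
Proof.
move=> szp szq; apply: (iffP allP) => [H|E i].
  apply: (@eq_from_nth _ [::]); first by rewrite !size_map szp.
  move=> i; rewrite size_map => lti; rewrite !(nth_map 0) ?szq -?szp //.
  by apply/twinP/H; rewrite mem_iota -szp.
rewrite mem_iota => /= lti; apply/twinP.
by rewrite -!(nth_map 0 [::]) ?szp ?szq // E.
Qed.

Variables (L : seq (seq nat)) (Lt : {in L, forall p, size p = t}).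

Lemma reps_sub : {subset reps nb Z t L <= L}.
Proof.
elim: (L) => //= p s IHs q; case: ifP => _; first by move=> /IHs qs; rewrite inE qs orbT.
by rewrite !inE => /predU1P[->|/IHs ->]; rewrite ?eqxx ?orbT.
Qed.

Lemma reps_twins p : p \in L -> exists2 q, q \in reps nb Z t L & twins nb Z t p q.
Proof.
elim: (L) => //= r s IHs; rewrite inE => /predU1P[->|/IHs[q qs tw]].
  case: ifP => [/hasP[q qs tw]|_]; first by exists q.
  by exists r; rewrite ?mem_head //; apply/allP => i _; apply/twinP.
by exists q => //; case: ifP => //; rewrite inE qs orbT.
Qed.

Lemma uniq_reps : uniq (map (map trace) (reps nb Z t L)).
Proof.
move: reps_sub Lt; rewrite /reps; elim: (L) => //= p s IHs.
move=> rs Ls; have rs' : {subset reps nb Z t s <= s}.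
  move=> q; elim: (s) => //= r s' IH; case: ifP => _; first by move=> /IH qs; rewrite inE qs orbT.
  by rewrite !inE => /predU1P[->|/IH ->]; rewrite ?eqxx ?orbT.
have Ls' : {in s, forall p, size p = t} by move=> q qs; apply: Ls; rewrite inE qs orbT.
case: ifP => [_|]; first exact: IHs.
move=> /negbT nh /=; rewrite IHs // andbT; apply: contra nh => /mapP[q qR E].
apply/hasP; exists q => //; apply/twinsP => //; first by apply: Ls; rewrite mem_head.
exact/Ls'/rs'.
Qed.

End Reps.

(** * Counting in biclique-free graphs *)

Section Sparse.
Variables (d : nat) (d0 : 0 < d) (bf : biclique_free_on d).

(** Since [nb] is reflexive, [q] may meet [p], but in at most [d] vertices; [d] further vertices of
    [q] would complete a biclique. Hence the bound 2d. *)
Lemma common_nbrs p q : uniq p -> uniq q -> {subset p <= vs} -> {subset q <= vs} ->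
  size p = d -> all (fun v => all (nb v) q) p -> size q < 2 * d.
Proof.
move=> up uq pvs qvs szp nbpq; rewrite ltnNge; apply/negP => le2.
set r := [seq w <- q | w \notin p].
have ler : d <= size r.
  have E : size [seq w <- q | w \in p] + size r = size q.
    by rewrite !size_filter (count_predC (mem p)).
  have : size [seq w <- q | w \in p] <= d.
    rewrite -szp; apply: uniq_leq_size; first exact: filter_uniq.
    by move=> w; rewrite mem_filter => /andP[].
  by move: le2; rewrite -E; lia.
have sub : {subset take d r <= q}.
  by move=> w /mem_take; rewrite mem_filter => /andP[].
have disj : ~~ has (mem p) (take d r).
  by apply/hasPn => w /mem_take; rewrite mem_filter => /andP[].
have /negP[] := bf up (take_uniq d (filter_uniq _ uq)) pvs
  (fun w wr => qvs _ (sub w wr)) szp (size_takel ler) disj.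
by apply/allP => v /(allP nbpq)/allP nbv; apply/allP => w /sub /nbv.
Qed.

(** Each proper narrowing makes all of [W] adjacent to one more vertex and shrinks [W] by a factor
    of about [k] at most. After [d] of them [common_nbrs] bounds [W]; if the descent ends earlier,
    [size_descend_core] does. *)
Lemma size_core k : (size (core nb vs k)).+1 <= 2 * d * maxn k 2 ^ d.
Proof.
set Z := core nb vs k; set K := maxn k 2.
have uZ : uniq Z by apply: subseq_uniq (core_sub k) uvs.
have Zvs : {subset Z <= vs} := mem_subseq (core_sub k).
(* Adding 1 to the sizes makes the loss multiplicative: |W| - 1 <= k |W'| yields |W| + 1 <= k |W'| +
   2 <= K (|W'| + 1), as [K] is at least 2. *)
pose good W := (size Z).+1 <= 2 * d * K ^ d \/ exists p, [/\ uniq p, {subset p <= vs},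
  size p < d, W = [seq z <- Z | all (fun v => nb v z) p]
  & (size Z).+1 <= K ^ size p * (size W).+1].
have gnarrow x W : x \in vs -> good W -> good (narrow nb k x W).
  move=> xvs [|[p [up pvs ltp EW leW]]]; first by left.
  rewrite /narrow; case: ifP => [/andP[ltW leK]|_]; last by right; exists p.
  have EW' : [seq z <- W | nb x z] = [seq z <- Z | all (fun v => nb v z) (x :: p)].
    by rewrite EW -filter_predI; apply: eq_filter => z.
  (* Narrowing by a vertex used before would leave [W] unchanged. *)
  have xp : x \notin p.
    apply/negP => xp; move: ltW; rewrite (_ : [seq z <- W | nb x z] = W) ?ltnn //.
    apply/all_filterP/allP => z; rewrite EW mem_filter => /andP[/allP].
    by move=> /(_ x xp).
  have pvs' : {subset x :: p <= vs} by move=> y; rewrite inE => /predU1P[->|/pvs].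
  have leW' : (size Z).+1 <= K ^ size (x :: p) * (size [seq z <- W | nb x z]).+1.
    apply: leq_trans leW _; rewrite /= expnSr -mulnA leq_mul2l; apply/orP; right.
    apply: (@leq_trans (k * size [seq z <- W | nb x z] + 2)); first by lia.
    rewrite mulnS addnC leq_add ?leq_maxr // leq_mul2r leq_maxl orbT //.
  have [szp|] := eqVneq (size (x :: p)) d; last first.
    move=> ne; right; exists (x :: p); split=> //=; first by rewrite xp.
    by rewrite ltn_neqAle ne.
  left; apply: leq_trans leW' _; rewrite szp mulnC leq_mul2r; apply/orP; right.
  rewrite EW'; apply: (@common_nbrs (x :: p)) => //.
  - by rewrite /= xp.
  - exact: filter_uniq.
  - by move=> z; rewrite mem_filter => /andP[_ /Zvs].
  - apply/allP => v vp; apply/allP => z; rewrite mem_filter => /andP[/allP H _].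
    exact: H.
have: good (descend nb vs k Z).
  rewrite /descend; elim: (size Z) => [|i IHi]; last first.
    rewrite iterS /pass; move: (iter _ _ _) IHi => W gW.
    have: {subset vs <= vs} by []; elim: {1 3}vs => //= x s IHs sv.
    apply: gnarrow; first by apply: sv; rewrite mem_head.
    by apply: IHs => y ys; apply: sv; rewrite inE ys orbT.
  by right; exists [::]; split=> //=; rewrite ?mul1n // filter_predT.
case=> // -[p [_ _ ltp _ leZ]]; apply: leq_trans leZ _.
rewrite mulnC; apply: leq_mul; last by rewrite leq_pexp2l ?leq_max ?orbT // ltnW.
by apply: (@leq_trans 2); [exact: size_descend_core|lia].
Qed.

(** Group the traces by their first [d] entries. A shorter prefix is the whole trace; a prefix of
    length [d] belongs only to its common neighbours, fewer than 2d. *)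
Lemma size_traces Z : uniq Z -> {subset Z <= vs} ->
  size (undup (map (trace Z) vs)) <= 2 * d * (size Z).+1 ^ d.
Proof.
move=> uZ Zvs; apply: leq_trans (_ : _ <= 2 * d * size (lists_upto d Z)) _; last first.
  by rewrite leq_mul2l size_lists_upto orbT.
apply: (size_fibers (h := take d)) => [p|c cZ].
  rewrite mem_undup => /mapP[v _ ->]; apply: mem_lists_upto; first by rewrite size_take_min geq_minl.
  by move=> z /mem_take; rewrite mem_filter => /andP[].
rewrite -size_filter; set F := filter _ _.
have uF : uniq F by rewrite filter_uniq ?undup_uniq.
have [ltc|lec] := ltnP (size c) d.
  suff le1 : size F <= 1 by apply: leq_trans le1 _; lia.
  apply: (@uniq_leq_size _ _ [:: c]) => // p; rewrite mem_filter inE => /andP[/eqP Ec _].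
  move: ltc; rewrite -Ec size_take_min gtn_min ltnn /= => ltp.
  by rewrite take_oversize // ltnW.
have [/nilP->//|/hasP[p0 p0F _]] : nilp F \/ has predT F.
  by case: (F) => [|p F']; [left|right].
move: p0F; rewrite mem_filter mem_undup => /andP[/eqP tc /mapP[v0 _ Ep0]].
have szc : size c = d.
  by apply/eqP; rewrite eqn_leq lec andbT -tc size_take_min geq_minl.
have sub : subseq c Z.
  by rewrite -tc Ep0; apply: subseq_trans (take_subseq _ _) (filter_subseq _ _).
set q := [seq v <- vs | all (nb v) c].
apply: (@leq_trans (size (map (trace Z) q))).
  apply: uniq_leq_size => // p; rewrite mem_filter mem_undup => /andP[/eqP Ec /mapP[v vvs Ep]].
  apply/mapP; exists v => //; rewrite mem_filter vvs andbT; apply/allP => z.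
  by rewrite -Ec Ep => /mem_take; rewrite mem_filter => /andP[].
rewrite size_map ltnW //; apply: (common_nbrs (p := c)) => //.
- exact: subseq_uniq sub uZ.
- exact: filter_uniq.
- by move=> z /(mem_subseq sub)/Zvs.
- by move=> v; rewrite mem_filter => /andP[].
apply/allP => z zc; apply/allP => v; rewrite mem_filter => /andP[/allP H _].
by rewrite nbC H.
Qed.

(** Different representatives have different lists of traces, so there are no more of them than
    lists of at most [t] traces. *)
Lemma size_kept t k :
  size (kept nb vs t k) <=
    size (core nb vs k) + t * (2 * d * (size (core nb vs k)).+1 ^ d).+1 ^ t.
Proof.
set Z := core nb vs k; rewrite /kept size_cat leq_add2l -/Z.
have uZ : uniq Z by apply: subseq_uniq (core_sub k) uvs.
have Zvs : {subset Z <= vs} := mem_subseq (core_sub k).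
set R := reps _ _ _ _.
have RL p : p \in R -> [/\ size p = t, {subset p <= vs} & linked nb p].
  by move=> /reps_sub; rewrite mem_links => /and3P[/eqP-> /allP pvs lp].
have -> : size (flatten R) = t * size R.
  elim: R RL => [|p R IHR] RL /=; first by rewrite muln0.
  rewrite size_cat mulnS IHR => [|q qR]; last by apply: RL; rewrite inE qR orbT.
  by congr (_ + _); case: (RL p (mem_head _ _)).
rewrite leq_mul2l; apply/orP; right.
rewrite -(size_map (map (trace Z)) R).
set Ts := undup (map (trace Z) vs).
apply: (@leq_trans (size (lists_upto t Ts))); last first.
  apply: leq_trans (size_lists_upto _ _) _; apply: leq_expl.
  by rewrite ltnS size_traces.
apply: uniq_leq_size => [|_ /mapP[p pR ->]].
  by apply: uniq_reps => p; rewrite mem_links => /and3P[/eqP].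
have [szp pvs _] := RL _ pR; apply: mem_lists_upto; first by rewrite size_map szp.
by move=> _ /mapP[v vp ->]; rewrite mem_undup map_f ?pvs.
Qed.

End Sparse.

End DominationCore.

(** * Approximating connected dominating sets inside the kernel *)

Section Approximation.
Variables (nb : rel nat) (vs : seq nat).
Hypotheses (nbC : symmetric nb) (nbxx : reflexive nb) (uvs : uniq vs).
Implicit Types (k t u v w x z : nat) (p q D S W Z : seq nat).

Definition joined D u v :=
  exists p, [/\ path nb u p, {subset u :: p <= D} & last u p = v].

Lemma joined_refl D u : u \in D -> joined D u u.
Proof. by move=> uD; exists [::]; split=> // x; rewrite inE => /eqP->. Qed.

Lemma joined_trans D : forall v u w, joined D u v -> joined D v w -> joined D u w.
Proof.
move=> v u w [p [pp pD pv]] [q [pq qD qw]]; exists (p ++ q).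
rewrite cat_path pp last_cat pv; split=> // x; rewrite -cat_cons mem_cat => /orP[/pD//|xq].
by apply: qD; rewrite inE xq orbT.
Qed.

Lemma joined_sym D u v : joined D u v -> joined D v u.
Proof.
move=> [p [pp pD <-]]; exists (rev (belast u p)); split.
- by rewrite rev_path; under eq_path do rewrite nbC.
- move=> x; rewrite inE mem_rev => /predU1P[->|xp]; apply: pD; first exact: mem_last.
  exact: mem_belast.
by case: p {pp pD} => //= x p; rewrite rev_cons last_rcons.
Qed.

Lemma joined_sub D S u v : {subset D <= S} -> joined D u v -> joined S u v.
Proof. by move=> DS [p [pp pD pv]]; exists p; split=> // x /pD/DS. Qed.

Lemma joined1 D u v : u \in D -> v \in D -> nb u v -> joined D u v.
Proof.
move=> uD vD nuv; exists [:: v]; split=> //=; first by rewrite nuv.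
by move=> x; rewrite !inE => /orP[] /eqP->.
Qed.

Lemma joined_in D u v : joined D u v -> v \in D.
Proof. by move=> [p [_ pD <-]]; apply/pD/mem_last. Qed.

Definition conn D := {in D &, forall u v, joined D u v}.

Lemma conn_star D r : {in D, forall u, joined D u r} -> conn D.
Proof.
by move=> H u v /H ur /H vr; apply: joined_trans ur (joined_sym vr).
Qed.

Lemma sub_filter_subseq (a b : pred nat) S :
  {in S, forall v, a v -> b v} -> subseq (filter a S) (filter b S).
Proof.
move=> ab; have -> : filter a S = filter a (filter b S).
  rewrite -filter_predI; apply: eq_in_filter => v /ab /=.
  by case: (a v) => // /(_ isT) ->.
exact: filter_subseq.
Qed.

Lemma connbP S : reflect (conn S) (connb nb S).
Proof.
rewrite /connb; set R := fun i => iter i (grow nb S) [seq v <- S | v == head 0 S].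
rewrite -/(R (size S)); have Rj i : {in R i, forall v, joined S v (head 0 S)}.
  elim: i => [|i IHi] v; rewrite mem_filter => /andP[].
    by move=> /eqP-> hS; apply: joined_refl.
  move=> /hasP[w wR nvw] vS; apply: joined_trans (IHi _ wR).
  by apply: joined1 => //; move: wR; rewrite /R; case: (i) => [|j]; rewrite mem_filter => /andP[].
have Rf i : exists a, R i = filter a S.
  by case: i => [|i]; eexists.
have Rsub i : subseq (R i) (R i.+1).
  have [a Ea] := Rf i; rewrite /R iterS -/(R i) Ea; apply: sub_filter_subseq => v vS av.
  by apply/hasP; exists v; rewrite // mem_filter av.
apply: (iffP allP) => [H|cS v vS].
  by apply: (@conn_star _ (head 0 S)) => v /H /Rj.
have hS : head 0 S \in S by case: (S) vS => // *; apply: mem_head.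
have : grow nb S (R (size S)) = R (size S).
  (* Until the reached set is stable, every round adds a vertex, which cannot go on for [size S]
     rounds. *)
  suff H i : i < size (R i) \/ grow nb S (R i) = R i.
    have [|//] := H (size S); have [a ->] := Rf (size S).
    by rewrite ltnNge size_filter count_size.
  elim: i => [|i [IHi|IHi]]; last by right; rewrite [R i.+1](_ : _ = R i).
    left; rewrite /R /= size_filter -has_count; apply/hasP; exists (head 0 S) => //=.
  have /size_subseq_leqif[leR eqR] := Rsub i.
  have [Eq|ne] := eqVneq (size (R i)) (size (R i.+1)).
    by right; move: eqR; rewrite Eq eqxx => /esym/eqP E; rewrite -E; exact/esym.
  by left; apply: leq_ltn_trans IHi _; rewrite ltn_neqAle ne.
set R' := R (size S); move=> E.
have hR : head 0 S \in R'.
  rewrite /R'; elim: (size S) => [|i IHi]; first by rewrite mem_filter eqxx.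
  exact: (mem_subseq (Rsub i)).
have [p [pp pS <-]] := cS _ _ hS vS.
elim: p (head 0 S) hR pp pS => //= x p IHp u uR /andP[nux pp] pS.
apply: IHp => // [|y yp]; last by apply: pS; rewrite inE yp orbT.
rewrite -E mem_filter pS ?inE ?eqxx ?orbT // andbT.
by apply/hasP; exists u; rewrite // nbC.
Qed.

Lemma linked_conn p : linked nb p -> conn p.
Proof.
elim: p => // v p IHp /= /andP[nv /IHp cp].
have vp : v \in v :: p := mem_head _ _.
have [/nilP-> u w|/hasP[x xp nvx]] := orP nv.
  by rewrite !inE => /eqP-> /eqP->; apply: joined_refl; rewrite mem_head.
apply: (@conn_star _ v) => u; rewrite inE => /predU1P[->|up]; first exact: joined_refl.
have pS : {subset p <= v :: p} by move=> y yp; rewrite inE yp orbT.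
apply: joined_trans (joined_sub pS (cp _ _ up xp)) _.
by apply: joined1 => //; [apply: pS|rewrite nbC].
Qed.

(** The last entry is the only one that may lack a later neighbour, and [p] now provides it. For
    this reason the root of a piece is put last. *)
Lemma linked_cat p q x : linked nb p -> linked nb (rcons q x) -> has (nb x) p ->
  linked nb (rcons q x ++ p).
Proof.
move=> lp; elim: q => [|y q IHq] /=; first by rewrite lp => _ ->; rewrite orbT.
move=> /andP[ny lq] nx; rewrite IHq // andbT.
by rewrite has_cat; case/orP: ny => [|->]; [case: (q)|rewrite orbT].
Qed.

Lemma linked_drop n p : linked nb p -> linked nb (drop n p).
Proof. by elim: p n => [|v p IHp] [|n] //= /andP[_ /IHp]. Qed.

Lemma linked_nseq n v p : linked nb (v :: p) -> linked nb (nseq n v ++ v :: p).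
Proof.
elim: n => //= n IHn lp; rewrite IHn // andbT; apply/orP; right.
by apply/hasP; exists v; rewrite // mem_cat mem_head orbT.
Qed.

(** Representatives have length exactly [t]. A shorter list is padded in front with copies of its
    first vertex, which stays linked as [nb] is reflexive; dropping the twins of the padding keeps
    the rest linked, since links lead to later entries. *)
Lemma kept_twins t k p : linked nb p -> {subset p <= vs} -> 0 < size p <= t ->
  exists q, [/\ linked nb q, {subset q <= kept nb vs t k}, size q = size p
    & map (trace nb (core nb vs k)) q = map (trace nb (core nb vs k)) p].
Proof.
set Z := core nb vs k; case: p => // v p lp pvs /andP[_ lept].
set n := t - size (v :: p); set P := nseq n v ++ v :: p.
have szP : size P = t by rewrite size_cat size_nseq subnK.
have PL : P \in links nb vs t.
  rewrite mem_links szP eqxx linked_nseq // andbT; apply/allP => w.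
  rewrite mem_cat => /orP[/nseqP[-> _]|/pvs//]; exact/pvs/mem_head.
have [q qR tw] := reps_twins nb Z t PL.
have : q \in links nb vs t by apply: reps_sub qR.
rewrite mem_links => /and3P[/eqP szq _ lq].
exists (drop n q); split.
- exact: linked_drop.
- move=> w /mem_drop wq; rewrite mem_cat; apply/orP; right.
  by apply/flattenP; exists q.
- by rewrite size_drop szq subKn.
move/twinsP: tw => /(_ szP szq) E.
by rewrite map_drop -E -map_drop drop_size_cat // size_nseq.
Qed.

Lemma kept_sub t k : {subset kept nb vs t k <= vs}.
Proof.
move=> v; rewrite mem_cat => /orP[/(mem_subseq (core_sub nb vs k))//|].
move=> /flattenP[p /reps_sub]; rewrite mem_links => /and3P[_ /allP pvs _] /pvs //.
Qed.

(* [LJoin a b] is [a] with the tree [b] attached below its root, so that every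
   rooted tree arises from single vertices by binary joins. *)
Inductive ltree := LOne of nat | LJoin of ltree & ltree.

Fixpoint root T := match T with LOne v => v | LJoin a _ => root a end.
Fixpoint verts T :=
  match T with LOne v => [:: v] | LJoin a b => verts a ++ verts b end.
Fixpoint wf T :=
  match T with
  | LOne _ => true | LJoin a b => [&& wf a, wf b & nb (root a) (root b)]
  end.
(** [v] is hung at the leaf [LOne w]. This changes no root, so the only new edge to check is that
    between [w] and [v]. *)
Fixpoint graft T w v :=
  match T with
  | LOne x => LJoin (LOne x) (LOne v)
  | LJoin a b => if w \in verts a then LJoin (graft a w v) b else LJoin a (graft b w v)
  end.

Lemma root_graft T w v : root (graft T w v) = root T.
Proof. by elim: T => //= a IHa b IHb; case: ifP. Qed.

Lemma root_verts T : root T \in verts T.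
Proof. by elim: T => [v|a IHa b IHb] /=; rewrite ?mem_head // mem_cat IHa. Qed.

Lemma perm_graft T w v : perm_eq (verts (graft T w v)) (v :: verts T).
Proof.
elim: T => [x|a IHa b IHb] /=; first by rewrite (perm_catC [:: x] [:: v]).
case: ifP => _ /=; first by rewrite -cat_cons perm_cat2r.
by rewrite -(perm_cat2l (verts a)) in IHb; rewrite (perm_trans IHb) // -cat1s perm_catCA.
Qed.

Lemma wf_graft T w v : wf T -> w \in verts T -> nb w v -> wf (graft T w v).
Proof.
elim: T => [x|a IHa b IHb] /=; first by rewrite inE => _ /eqP->.
move=> /and3P[wa wb nab]; rewrite mem_cat => wab nwv.
by case: ifP wab => [wva _|_ /= wvb] /=; rewrite root_graft nab ?wa ?wb ?IHa ?IHb.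
Qed.

Lemma path_exit (P : pred nat) u p : path nb u p -> P u -> ~~ P (last u p) ->
  exists x y, [/\ P x, ~~ P y, y \in p & nb x y].
Proof.
elim: p u => [|v p IHp] u /=; first by move=> _ ->.
move=> /andP[nuv pp] Pu nP; have [Pv|nPv] := boolP (P v).
  by have [x [y [Px Py yp nxy]]] := IHp v pp Pv nP; exists x, y; rewrite inE yp orbT.
by exists u, v; rewrite mem_head.
Qed.

(** A path in [D] from the root to a vertex not yet reached leaves the tree along some edge, whose
    far end is grafted. *)
Lemma spanning_ltree D : D != [::] -> uniq D -> conn D ->
  exists T, [/\ wf T, {subset verts T <= D}, {subset D <= verts T}
    & size (verts T) = size D].
Proof.
move=> D0 uD cD.
suff H n : n < size D -> exists T, [/\ wf T, uniq (verts T), {subset verts T <= D}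
    & size (verts T) = n.+1].
  have [|T [wT uT TD szT]] := H (size D).-1; first by case: (D) D0.
  have {}szT : size (verts T) = size D by rewrite szT prednK // lt0n size_eq0.
  exists T; split=> // v vD; have [|_ ->//] := uniq_min_size uT TD; by rewrite szT.
elim: n => [|n IHn] ltn.
  case: (D) D0 => // v D' _; exists (LOne v); split=> // x.
  by rewrite !inE => ->.
have [T [wT uT TD szT]] := IHn (ltnW ltn).
have [y yD yT] : exists2 y, y \in D & y \notin verts T.
  apply/hasP; apply: contraLR ltn => /hasPn H; rewrite -leqNgt -szT.
  by apply: uniq_leq_size => // x /H; rewrite negbK.
have [p [pp pD Ey]] := cD _ _ (TD _ (root_verts T)) yD.
rewrite -Ey in yT; have [x [z [xT zT zp nxz]]] := path_exit (P := mem (verts T)) pp (root_verts T) yT.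
exists (graft T x z); split.
- exact: wf_graft.
- by rewrite (perm_uniq (perm_graft _ _ _)) /= uT andbT.
- move=> w; rewrite (perm_mem (perm_graft _ _ _)) inE => /predU1P[->|/TD//].
  by apply: pD; rewrite inE zp orbT.
by rewrite (perm_size (perm_graft _ _ _)) /= szT.
Qed.

(** * Cutting a spanning tree into pieces *)

Section Splitting.
Variables (r k : nat) (r0 : 0 < r).
(** A tuple has to hold two pieces of at most [r + 1] vertices each, and one extra vertex attached
    to the core. *)
Let t := r.*2 + 3.
Let Z := core nb vs k.
Let K := kept nb vs t k.
Variables (D : seq nat) (Dvs : {subset D <= vs}).
Hypothesis DU : {in D, forall v, exists u, [/\ u \in D, nb u v & has (nb u) Z]}.

(* [rcons p (root T)] is the piece around the root that is still to be replaced,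
   [E] replaces the [c] pieces already cut off.  Everything in [E] is connected
   to a vertex of the core adjacent to that last piece, and stays so when the
   piece is replaced by twins. *)
Lemma split_ltree T : wf T -> {subset verts T <= D} ->
  exists p (E : seq nat) (c : nat),
  [/\ [/\ linked nb (rcons p (root T)), {subset rcons p (root T) <= D},
        {subset E <= K} & {in verts T, forall v, v \in rcons p (root T) \/
          exists2 w, w \in E & trace nb Z v = trace nb Z w}],
      {in E, forall x, exists z v, [/\ z \in Z, joined E x z,
         v \in rcons p (root T) & nb v z]},
      size p <= r, size E + (size p).+1 <= size (verts T) + 4 * c
    & (size p).+1 + r * c <= size (verts T)].
Proof.
elim: T => [v|a IHa b IHb] /=.
  move=> _ vD; exists [::], [::], 0; split=> //=; last by rewrite muln0.
  by split=> // w wv; left.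
move=> /and3P[/IHa{}IHa /IHb{}IHb nab] abD.
have [|pa [Ea [qa [[lpa paD EaK twa] ja sza1 sza2 sza3]]]] := IHa.
  by move=> v va; apply: abD; rewrite mem_cat va.
have [|pb [Eb [qb [[lpb pbD EbK twb] jb szb1 szb2 szb3]]]] := IHb.
  by move=> v vb; apply: abD; rewrite mem_cat vb orbT.
set Pa := rcons pa (root a) in lpa paD twa ja *.
set Pb := rcons pb (root b) in lpb pbD twb jb *.
have lP : linked nb (Pb ++ Pa).
  by apply: linked_cat => //; apply/hasP; exists (root a); rewrite ?mem_rcons ?mem_head // nbC.
have PD : {subset Pb ++ Pa <= D} by move=> v; rewrite mem_cat => /orP[/pbD|/paD].
have szP : size (Pb ++ Pa) = (size pa).+1 + (size pb).+1.
  by rewrite size_cat !size_rcons addnC.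
set E := Ea ++ Eb.
have EK : {subset E <= K} by move=> v; rewrite mem_cat => /orP[/EaK|/EbK].
have szE : size E = size Ea + size Eb by rewrite size_cat.
have tw : {in verts a ++ verts b, forall v, v \in Pb ++ Pa \/
    exists2 w, w \in E & trace nb Z v = trace nb Z w}.
  move=> v; rewrite mem_cat => /orP[/twa|/twb] [vP|[w wE Ew]].
  - by left; rewrite mem_cat vP orbT.
  - by right; exists w => //; rewrite mem_cat wE.
  - by left; rewrite mem_cat vP.
  - by right; exists w => //; rewrite mem_cat wE orbT.
have jE : {in E, forall x, exists z v, [/\ z \in Z, joined E x z, v \in Pb ++ Pa & nb v z]}.
  move=> x; rewrite mem_cat => /orP[/ja|/jb] [z [v [zZ jz vP nvz]]]; exists z, v; split=> //.
  - by apply: joined_sub jz => y yE; rewrite mem_cat yE.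
  - by rewrite mem_cat vP orbT.
  - by apply: joined_sub jz => y yE; rewrite mem_cat yE orbT.
  - by rewrite mem_cat vP.
(* A merged piece of at most [r + 1] vertices is carried upwards; a larger one is cut off and
   replaced by twins. *)
have [small|big] := leqP (size (Pb ++ Pa)) r.+1.
  exists (Pb ++ pa), E, (qa + qb); rewrite rcons_cat -/Pa size_cat; split=> //.
  - by move: small; rewrite szP size_rcons; lia.
  - by rewrite size_rcons szE size_cat; lia.
  - by rewrite size_rcons size_cat; lia.
have raP : root a \in Pb ++ Pa by rewrite mem_cat orbC mem_rcons mem_head.
(* [u] joins the tuple, so that its twin is near [z0]; it also stays in the next piece, so that [z0]
   remains near whatever replaces that piece. *)
have [u [uD nua /hasP[z0 z0Z nuz]]] := DU (PD _ raP).
have [] := @kept_twins t k (u :: Pb ++ Pa).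
- by rewrite /= lP andbT; apply/orP; right; apply/hasP; exists (root a).
- by move=> v; rewrite inE => /predU1P[->|/PD vD]; apply: Dvs.
- by move=> /=; rewrite szP /t; lia.
move=> Q [lQ QK szQ trQ].
have twQ v : v \in u :: Pb ++ Pa -> exists2 w, w \in Q & trace nb Z v = trace nb Z w.
  move=> /(map_f (trace nb Z)); rewrite -trQ => /mapP[w wQ Ew]; by exists w.
have trz z v w : z \in Z -> trace nb Z v = trace nb Z w -> nb v z -> nb w z.
  move=> zZ Evw nvz; have: z \in trace nb Z v by rewrite mem_filter nvz.
  by rewrite Evw mem_filter => /andP[].
set F := z0 :: Q ++ E.
have QF : {subset Q <= F} by move=> v vQ; rewrite inE mem_cat vQ orbT.
have EF : {subset E <= F} by move=> v vE; rewrite inE mem_cat vE !orbT.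
have z0F : z0 \in F := mem_head _ _.
have jQ : {in Q, forall v, joined F v z0}.
  have [w wQ Ew] := twQ u (mem_head _ _) => v vQ.
  apply: joined_trans (joined_sub QF (linked_conn lQ vQ wQ)) _.
  by apply: joined1 => //; [exact: QF|exact: trz nuz].
(* The cut costs 4: [z0] and the twin of [u] are added, while [u] and the root remain in the new
   piece. It trades at least [r + 2] vertices for these remaining two, which pays [r] per cut in the
   last bound. *)
exists [:: u], F, (qa + qb).+1; split.
- split.
  + by rewrite /= nua.
  + by move=> v; rewrite !inE => /orP[] /eqP-> //; apply: PD.
  + move=> v; rewrite inE mem_cat => /predU1P[->|/orP[/QK|/EK]//].
    by rewrite mem_cat z0Z.
  + move=> v /tw[vP|[w wE Ew]]; right; last by exists w => //; apply: EF.
    have [|w wQ Ew] := twQ v; first by rewrite inE vP orbT.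
    by exists w => //; apply: QF.
- move=> x xF; exists z0, u; split=> //; last by rewrite mem_head.
  move: xF; rewrite inE mem_cat => /predU1P[->|/orP[/jQ//|/jE]]; first exact: joined_refl.
  move=> [z [v [zZ jz vP nvz]]].
  have [|w wQ Ew] := twQ v; first by rewrite inE vP orbT.
  apply: joined_trans (joined_sub EF jz) (joined_trans _ (jQ _ wQ)).
  apply: joined1; [exact/EF/(joined_in jz)|exact: QF|rewrite nbC; exact: trz nvz].
- by [].
- by rewrite /F /= size_cat szQ szE /= szP size_cat; lia.
by move: big; rewrite szP size_cat /= mulnS mulnDr; lia.
Qed.

End Splitting.

Lemma approx_cds r k D : 0 < r -> uniq D -> {subset D <= vs} -> size D <= k ->
  dominated nb vs D -> conn D ->
  exists (E : seq nat) (c : nat), [/\ {subset E <= kept nb vs (r.*2 + 3) k},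
    conn E, dominated nb vs E,
    size E <= size D + 4 * c & r * c <= size D].
Proof.
move=> r0 uD Dvs leD dom cD; set Z := core nb vs k.
have Zvs : {subset Z <= vs} := mem_subseq (core_sub nb vs k).
have [D0|D0] := eqVneq D [::].
  by subst D; exists [::], 0; rewrite !muln0; split=> // v.
have coreZ := core_core nbC uvs (k := k).
have DU : {in D, forall v, exists u, [/\ u \in D, nb u v & has (nb u) Z]}.
  (* A core vertex can only be dominated by members of [D1], so [D1] dominates the core and, having
     at most [k] vertices, everything. *)
  move=> v /Dvs vvs; set D1 := [seq u <- D | has (nb u) Z].
  have /hasP[u uD1 nvu] : has (nb v) D1.
    apply: coreZ vvs => [u||z zZ].
    - by rewrite mem_filter => /andP[_ /Dvs].
    - by apply: leq_trans leD; rewrite size_filter count_size.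
    have /hasP[u u_D nzu] := dom _ (Zvs _ zZ).
    apply/hasP; exists u => //; rewrite mem_filter u_D andbT.
    by apply/hasP; exists z; rewrite // nbC.
  by exists u; move: uD1; rewrite mem_filter nbC => /andP[].
have [T [wT TD DT szT]] := spanning_ltree D0 uD cD.
have [p [E [c [[lP PD EK tw] jE lep sz1 sz2]]]] := split_ltree (k := k) r0 Dvs DU wT TD.
set P := rcons p (root T) in lP PD tw jE.
have [||Q [lQ QK szQ trQ]] := @kept_twins (r.*2 + 3) k P lP.
- by move=> v /PD/Dvs.
- by rewrite size_rcons; lia.
have twQ v : v \in P -> exists2 w, w \in Q & trace nb Z v = trace nb Z w.
  by move=> /(map_f (trace nb Z)); rewrite -trQ => /mapP[w wQ Ew]; exists w.
set F := Q ++ E.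
have QF : {subset Q <= F} by move=> v vQ; rewrite mem_cat vQ.
have EF : {subset E <= F} by move=> v vE; rewrite mem_cat vE orbT.
have FK : {subset F <= kept nb vs (r.*2 + 3) k}.
  by move=> v; rewrite mem_cat => /orP[/QK|/EK].
have twF v : v \in D -> exists2 w, w \in F & trace nb Z v = trace nb Z w.
  move=> /DT/tw[/twQ|] [w wF Ew]; exists w => //; [exact: QF|exact: EF].
have trz z v w : z \in Z -> trace nb Z v = trace nb Z w -> nb v z -> nb w z.
  move=> zZ Evw nvz; have: z \in trace nb Z v by rewrite mem_filter nvz.
  by rewrite Evw mem_filter => /andP[].
exists F, c; split=> //.
- have [w0 w0Q _] := twQ (root T) ltac:(by rewrite mem_rcons mem_head).
  have jQ : {in Q, forall v, joined F v w0}.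
    by move=> v vQ; apply: joined_sub QF (linked_conn lQ vQ w0Q).
  apply: (@conn_star _ w0) => v; rewrite mem_cat => /orP[/jQ//|/jE].
  move=> [z [u [zZ jz /twQ[w wQ Ew] nuz]]].
  apply: joined_trans (joined_sub EF jz) (joined_trans _ (jQ _ wQ)).
  apply: joined1; [exact/EF/(joined_in jz)|exact: QF|rewrite nbC; exact: trz nuz].
(* [F] may have more than [k] vertices, so the core property is applied to one twin for each vertex
   of [D]. *)
- pose f v := head v [seq w <- F | trace nb Z v == trace nb Z w].
  have fP v : v \in D -> f v \in F /\ trace nb Z v = trace nb Z (f v).
    move=> /twF[w wF Ew]; have: f v \in [seq w <- F | trace nb Z v == trace nb Z w].
      have: w \in [seq w <- F | trace nb Z v == trace nb Z w].
        by rewrite mem_filter Ew eqxx.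
      by rewrite /f; case: filter => // *; apply: mem_head.
    by rewrite mem_filter => /andP[/eqP ? ?].
  have dom' : dominated nb vs (map f D).
    apply: coreZ => [_ /mapP[v /fP[fF _] ->]||z zZ].
    - exact/kept_sub/FK.
    - by rewrite size_map.
    have /hasP[v vD nzv] := dom _ (Zvs _ zZ).
    apply/hasP; exists (f v); first exact: map_f.
    by rewrite nbC; apply: trz zZ (fP v vD).2 _; rewrite nbC.
  move=> v /dom'/hasP[_ /mapP[w wD ->] nvw]; apply/hasP; exists (f w) => //.
  by have [] := fP _ wD.
- by rewrite size_cat szQ size_rcons -szT; lia.
by rewrite -szT; lia.
Qed.

End Approximation.

(** * The reduction runs in polynomial time *)

(** Higher-order patterns read off the subterms as functions of the input. Conditionals have no
    pattern of their own and are left to the last case. *)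
Ltac pt_step :=
  cbn beta;
  lazymatch goal with
  | |- ptime (fun y => y) => exact: ptime_id
  | |- ptime (@fst _ _) => exact: ptime_fst
  | |- ptime (@snd _ _) => exact: ptime_snd
  | |- ptime (fun y => fst (@?f y)) => apply: (ptime_fst1 (f := f))
  | |- ptime (fun y => snd (@?f y)) => apply: (ptime_snd1 (f := f))
  | |- ptime (fun y => (@?f y, @?g y)) => apply: (ptime_pair (f := f) (g := g))
  | |- ptime (fun y => @?b y && @?c y) => apply: (ptime_andb (b := b) (c := c))
  | |- ptime (fun y => @?b y || @?c y) => apply: (ptime_orb (b := b) (c := c))
  | |- ptime (fun y => ~~ @?b y) => apply: (ptime_negb (b := b))
  | |- ptime (fun y => @?f y :: @?g y) => apply: (ptime_cons (a := f) (s := g))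
  | |- ptime (fun y => @?f y ++ @?g y) => apply: (ptime_cat (s1 := f) (s2 := g))
  | |- ptime (fun y => map (@?f y) (@?g y)) => apply: (ptime_map (f := f) (l := g))
  | |- ptime (fun y => filter (@?f y) (@?g y)) => apply: (ptime_filter (f := f) (l := g))
  | |- ptime (fun y => has (@?f y) (@?g y)) => apply: (ptime_has (f := f) (l := g))
  | |- ptime (fun y => all (@?f y) (@?g y)) => apply: (ptime_all (f := f) (l := g))
  | |- ptime (fun y => flatten (@?f y)) => apply: (ptime_flatten (l := f))
  | |- ptime (fun y => nilp (@?f y)) => apply: (ptime_nilp (s := f))
  | |- ptime (fun y => head ?d (@?f y)) => apply: (ptime_head d (s := f))
  | |- ptime (fun y => nth ?d (@?f y) (@?g y)) => apply: (ptime_nth d (l := f) (n := g))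
  | |- ptime (fun y => size (@?f y)) => apply: (ptime_sizes (l := f))
  | |- ptime (fun y => S (@?f y)) => apply: (ptime_succ (n := f))
  | |- ptime (fun y => predn (@?f y)) => apply: (ptime_pred (n := f))
  | |- ptime (fun y => @?f y * @?g y) => apply: (ptime_muln (m := f) (n := g))
  | |- ptime (fun y => leq (@?f y) (@?g y)) => apply: (ptime_leq (m := f) (n := g))
  | |- ptime (fun y => iota 0 (@?f y)) => apply: (ptime_iota0 (n := f))
  | |- ptime (fun y => @eq_op Datatypes_nat__canonical__eqtype_Equality (@?f y) (@?g y)) =>
      apply: (ptime_eqn (m := f) (n := g))
  | |- ptime (fun y => @eq_op Datatypes_bool__canonical__eqtype_Equality (@?f y) (@?g y)) =>
      apply: (ptime_eqb (b := f) (c := g))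
  | |- ptime (fun y => in_mem (@?f y) (mem (@?g y))) => apply: (ptime_mem (u := f) (s := g))
  | |- ptime (fun _ => ?c) => exact: ptime_const
  | |- _ => apply: ptime_if
  end.
Ltac pt := repeat first [assumption | pt_step].

Section Ptime.
Context {X : Type} {EX : encodable X}.
Variables (nb : X -> rel nat) (vs : X -> seq nat).
Hypothesis pnb0 : ptime (fun y : X * nat * nat => nb y.1.1 y.1.2 y.2).
Hypothesis pvs0 : ptime vs.

Lemma ptime_nb Y (EY : encodable Y) (h : Y -> X) (u v : Y -> nat) :
  ptime h -> ptime u -> ptime v -> ptime (fun y => nb (h y) (u y) (v y)).
Proof.
move=> ph pu pv.
by apply: (ptime_comp pnb0 (f := fun y => (h y, u y, v y))); pt.
Qed.

Lemma ptime_vs Y (EY : encodable Y) (h : Y -> X) :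
  ptime h -> ptime (fun y => vs (h y)).
Proof. exact: ptime_comp pvs0. Qed.

(* Redefined after each lemma below: the patterns mention the section variables. *)
Ltac pt_ext := fail.
Ltac ptn := repeat first
  [ assumption
  | pt_ext
  | lazymatch goal with
    | |- ptime (fun y => nb (@?h y) (@?u y) (@?v y)) =>
        apply: (ptime_nb (h := h) (u := u) (v := v))
    | |- ptime (fun y => vs (@?h y)) => apply: (ptime_vs (h := h))
    end
  | match goal with
    | H : ptime ?g |- ptime (fun y => ?g (@?q y)) => apply: (ptime_comp H (f := q))
    end
  | pt_step ].

Lemma ptime_narrow Y (EY : encodable Y) (h : Y -> X) (k x : Y -> nat) (W : Y -> seq nat) :
  ptime h -> ptime k -> ptime x -> ptime W ->
  ptime (fun y => narrow (nb (h y)) (k y) (x y) (W y)).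
Proof. by move=> ph pk px pW; rewrite /narrow; ptn. Qed.

Ltac pt_ext ::= lazymatch goal with
  | |- ptime (fun y => narrow (nb (@?h y)) (@?k y) (@?x y) (@?W y)) =>
      apply: (ptime_narrow (h := h) (k := k) (x := x) (W := W))
  end.

Lemma ptime_pass Y (EY : encodable Y) (h : Y -> X) (k : Y -> nat) (W : Y -> seq nat) :
  ptime h -> ptime k -> ptime W ->
  ptime (fun y => pass (nb (h y)) (vs (h y)) (k y) (W y)).
Proof.
move=> ph pk pW.
apply: (ptime_foldr (f := fun y x W => narrow (nb (h y)) (k y) x W) (M := fun y => esize (W y))).
- by ptn.
- by [].
- by ptn.
- exact: ptime_size.
by move=> y s1 s2 _; apply/esize_subseq/pass_sub.
Qed.

Ltac pt_ext ::= lazymatch goal with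
  | |- ptime (fun y => pass (nb (@?h y)) (vs (@?h y)) (@?k y) (@?W y)) =>
      apply: (ptime_pass (h := h) (k := k) (W := W))
  end.

Lemma ptime_descend Y (EY : encodable Y) (h : Y -> X) (k : Y -> nat) (Z : Y -> seq nat) :
  ptime h -> ptime k -> ptime Z ->
  ptime (fun y => descend (nb (h y)) (vs (h y)) (k y) (Z y)).
Proof.
move=> ph pk pZ.
apply: (ptime_iter (f := fun y => pass (nb (h y)) (vs (h y)) (k y))
  (M := fun y => esize (Z y))).
- by ptn.
- by ptn.
- by [].
- exact: ptime_size.
move=> y i _; apply/esize_subseq; elim: i => //= i; exact/subseq_trans/pass_sub.
Qed.

Ltac pt_ext ::= lazymatch goal with
  | |- ptime (fun y => descend (nb (@?h y)) (vs (@?h y)) (@?k y) (@?W y)) =>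
      apply: (ptime_descend (h := h) (k := k) (Z := W))
  end.

Lemma ptime_core Y (EY : encodable Y) (h : Y -> X) (k : Y -> nat) :
  ptime h -> ptime k -> ptime (fun y => core (nb (h y)) (vs (h y)) (k y)).
Proof.
move=> ph pk.
apply: (ptime_iter (f := fun y => shrink (nb (h y)) (vs (h y)) (k y))
  (M := fun y => esize (vs (h y)))).
- rewrite /shrink; ptn.
- by ptn.
- by ptn.
- by apply: ptime_size; ptn.
move=> y i _; apply/esize_subseq; elim: i => //= i; exact/subseq_trans/shrink_sub.
Qed.

Ltac pt_ext ::= lazymatch goal with
  | |- ptime (fun y => core (nb (@?h y)) (vs (@?h y)) (@?k y)) =>
      apply: (ptime_core (h := h) (k := k))
  end.

(** [t] is a constant, not an input: the induction builds a program for each [t], with a polynomial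
    whose degree may grow with [t]. *)
Lemma ptime_links Y (EY : encodable Y) (h : Y -> X) t :
  ptime h -> ptime (fun y => links (nb (h y)) (vs (h y)) t).
Proof.
move=> ph; elim: t => [|t IHt]; first exact: ptime_const.
move: IHt; rewrite /links /=; set L := fun y => iter t _ _ => pL.
change (ptime (fun y => extend (nb (h y)) (vs (h y)) (L y))).
by rewrite /extend; ptn.
Qed.

Lemma ptime_kept Y (EY : encodable Y) (h : Y -> X) (k : Y -> nat) t :
  ptime h -> ptime k -> ptime (fun y => kept (nb (h y)) (vs (h y)) t (k y)).
Proof.
move=> ph pk; have pL := ptime_links t ph; rewrite /kept.
have pC : ptime (fun y => core (nb (h y)) (vs (h y)) (k y)) by ptn.
apply: ptime_cat => //; apply: ptime_flatten.
move: pL pC; set L := fun y => links _ _ _; set Z := fun y => core _ _ _ => pL pZ.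
change (ptime (fun y => reps (nb (h y)) (Z y) t (L y))).
apply: (ptime_foldr (f := fun y p acc =>
  if has (twins (nb (h y)) (Z y) t p) acc then acc else p :: acc)
  (M := fun y => esize (L y))).
- by rewrite /twins /twin; ptn.
- exact: ptime_const.
- by [].
- exact: ptime_size.
move=> y s1 s2 ->; apply: leq_trans (esize_catr _ _); apply: esize_subseq.
elim: s2 => //= p s2 IHs; case: ifP => _; last by rewrite eqxx.
exact: subseq_trans (subseq_cons _ _).
Qed.

Lemma ptime_kernel Y (EY : encodable Y) (h : Y -> X) (k : Y -> nat) t :
  ptime h -> ptime k -> ptime (fun y => kernel (nb (h y)) (vs (h y)) t (k y)).
Proof.
move=> ph pk; have := ptime_kept t ph pk; rewrite /kernel.
set K := fun y => kept _ _ _ _ => pK.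
by change (ptime (fun y => [seq v <- vs (h y) | v \in K y])); ptn.
Qed.

Lemma ptime_cdsb Y (EY : encodable Y) (h : Y -> X) (S : Y -> seq nat) :
  ptime h -> ptime S -> ptime (fun y => cdsb (nb (h y)) (vs (h y)) (S y)).
Proof.
move=> ph pS; have pR : ptime (fun y => iter (size (S y)) (grow (nb (h y)) (S y))
    [seq v <- S y | v == head 0 (S y)]).
  apply: (ptime_iter (f := fun y => grow (nb (h y)) (S y)) (M := fun y => esize (S y))).
  - by rewrite /grow; ptn.
  - by ptn.
  - by ptn.
  - exact: ptime_size.
  by move=> y [|i] _; apply: esize_filter.
move: pR; rewrite /cdsb /connb; set R := fun y => iter _ _ _ => pR.
apply: ptime_andb; first by ptn.
change (ptime (fun y => all (fun v => v \in R y) (S y))); by ptn.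
Qed.

End Ptime.

(** * Reduction and lifting on adjacency matrices *)

Definition entry (M : seq (seq bool)) u v := nth false (nth [::] M u) v.
Definition near M u v := (u == v) || entry M u v.

Definition kernel_vertices t (x : seq (seq bool) * nat) :=
  kernel (near x.1) (iota 0 (size x.1)) t x.2.

Definition reduce t (x : seq (seq bool) * nat) : seq (seq bool) * nat :=
  let L := kernel_vertices t x in
  ([seq [seq entry x.1 u v | v <- L] | u <- L], x.2).

Definition lift_seq t (y : (seq (seq bool) * nat) * ((seq (seq bool) * nat) * seq bool)) :=
  let L := kernel_vertices t y.1 in
  let S := [seq nth 0 L i | i <- [seq i <- iota 0 (size L) | nth false y.2.2 i]] in
  let vs := iota 0 (size y.1.1) in
  if cdsb (near y.1.1) vs S then [seq v \in S | v <- vs] else [seq true | v <- vs].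

Lemma ptime_near : ptime (fun y : seq (seq bool) * nat * nat => near y.1.1 y.1.2 y.2).
Proof. by rewrite /near /entry; pt. Qed.

Lemma ptime_kernel_vertices t : ptime (kernel_vertices t).
Proof.
apply: (ptime_kernel (nb := near) (vs := fun M => iota 0 (size M)) ptime_near _ t
  (h := fst) (k := snd)); by pt.
Qed.

Lemma ptime_reduce t : ptime (reduce t).
Proof.
have pL := ptime_kernel_vertices t; rewrite /reduce /entry.
move: pL; set L := kernel_vertices t => pL; pt.
- exact: ptime_comp pL ptime_fst.
Qed.

Lemma ptime_lift_seq t : ptime (lift_seq t).
Proof.
pose L (y : (seq (seq bool) * nat) * ((seq (seq bool) * nat) * seq bool)) :=
  kernel_vertices t y.1.
assert (pL : ptime L) by exact: ptime_comp (ptime_kernel_vertices t) ptime_fst.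
pose S y := [seq nth 0 (L y) i | i <- [seq i <- iota 0 (size (L y)) | nth false y.2.2 i]].
assert (pS : ptime S).
  by rewrite /S; pt; try exact: pL; exact: ptime_comp pL ptime_fst.
change (ptime (fun y => if cdsb (near y.1.1) (iota 0 (size y.1.1)) (S y)
  then [seq v \in S y | v <- iota 0 (size y.1.1)] else [seq true | v <- iota 0 (size y.1.1)])).
apply: ptime_if; last by pt.
  apply: (ptime_cdsb (nb := near) (vs := fun M => iota 0 (size M)) ptime_near _
    (h := fun y => y.1.1) (S := S)) => //; by pt.
by pt; exact: ptime_comp pS ptime_fst.
Qed.

(** * Reduction and lifting on graphs *)

Lemma cdsb_eq_mem nb vs (D1 D2 : seq nat) : symmetric nb -> reflexive nb ->
  D1 =i D2 -> cdsb nb vs D1 = cdsb nb vs D2.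
Proof.
move=> nbC nbxx eqD; rewrite /cdsb; congr andb.
  by apply: eq_all => v; apply: eq_has_r.
by apply/(connbP nbC nbxx)/(connbP nbC nbxx) => cD u v uD vD;
  apply: joined_sub (cD u v _ _) => [w||]; rewrite ?eqD // -?eqD.
Qed.

(** * Graphs as relations on natural numbers *)

Section Transfer.
Variables (G : graph) (nb : rel nat) (g : 'I_(nverts G) -> nat).
Hypotheses (nbC : symmetric nb) (nbxx : reflexive nb) (injg : injective g).
Hypothesis nbg : forall i j, nb (g i) (g j) = (i == j) || adj i j.

Lemma connect_joined (S : {set 'I_(nverts G)}) (q : seq nat) u :
  u \in S -> path nb (g u) q -> {subset q <= map g (enum S)} ->
  exists w, last (g u) q = g w /\ connect (induced_adj S) u w.
Proof.
elim: q u => [|x q IHq] u uS /=; first by exists u; rewrite connect0.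
move=> /andP[nux pq] qS; have /mapP[v] := qS x (mem_head _ _).
rewrite mem_enum => vS Ex; rewrite Ex in nux pq *.
have [|w [-> cw]] := IHq v vS pq; first by move=> y yq; apply: qS; rewrite inE yq orbT.
exists w; split=> //; apply: connect_trans cw; move: nux; rewrite nbg.
by case/predU1P => [->//|auv]; apply: connect1; apply/and3P.
Qed.

(** With [val] as [g] this describes the input graph; with the kernel vertices named as in the input
    graph it describes the kernel. Both then share one relation [nb]. *)
Lemma connected_dominatingE (S : {set 'I_(nverts G)}) :
  connected_dominating S = cdsb nb (map g (enum 'I_(nverts G))) (map g (enum S)).
Proof.
rewrite /connected_dominating /cdsb; congr andb.
  apply/forallP/allP => [dS _ /mapP[v _ ->]|dS v].
    have /orP[vS|/existsP[u /andP[uS auv]]] := dS v; apply/hasP.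
      by exists (g v); rewrite ?map_f ?mem_enum.
    by exists (g u); rewrite ?map_f ?mem_enum // nbg adj_sym auv orbT.
  have /hasP[_ /mapP[u + ->]] := dS (g v) (map_f _ (mem_enum _ v)).
  rewrite mem_enum nbg => uS /predU1P[->|avu]; first by rewrite uS.
  by apply/orP; right; apply/existsP; exists u; rewrite uS adj_sym.
apply/forallP/(connbP nbC nbxx) => [cS _ _ /mapP[u + ->] /mapP[v + ->]|cS u].
  rewrite !mem_enum => uS vS; have /implyP/(_ uS)/forallP/(_ v)/implyP/(_ vS) := cS u.
  case/connectP => p; elim: p u uS => [|w p IHp] u uS /=.
    by move=> _ ->; apply: joined_refl; rewrite map_f ?mem_enum.
  move=> /andP[/and3P[_ wS auw] pp] Ev.
  apply: joined_trans (IHp w wS pp Ev); apply: joined1; rewrite ?map_f ?mem_enum //.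
  by rewrite nbg auw orbT.
apply/implyP => uS; apply/forallP => v; apply/implyP => vS.
have [||q [pq qS Ev]] := cS (g u) (g v); try by rewrite map_f ?mem_enum.
have [|w [Ew cw]] := connect_joined uS pq.
  by move=> x xq; apply: qS; rewrite inE xq orbT.
by move: Ew; rewrite Ev => /injg->.
Qed.

End Transfer.

Definition adj_matrix (G : graph) : seq (seq bool) :=
  [seq [seq adj i j | j <- enum 'I_(nverts G)] | i <- enum 'I_(nverts G)].

Lemma graph_codeE G : graph_code G = enc (adj_matrix G).
Proof.
rewrite /graph_code /adj_matrix; congr tlist; rewrite -[RHS]map_comp.
by apply: eq_map => i; congr tlist; rewrite -[RHS]map_comp.
Qed.

Lemma size_adj_matrix G : size (adj_matrix G) = nverts G.
Proof. by rewrite size_map size_enum_ord. Qed.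

Lemma entry_adj G (i j : 'I_(nverts G)) : entry (adj_matrix G) i j = adj i j.
Proof.
rewrite /entry (nth_map i) ?size_enum_ord // (nth_map i) ?size_enum_ord //.
by rewrite !nth_ord_enum.
Qed.

Lemma entry_out G u v : (nverts G <= u) || (nverts G <= v) -> entry (adj_matrix G) u v = false.
Proof.
rewrite /entry; have [le|lt] := leqP (nverts G) u.
  by rewrite (nth_default [::]) ?nth_nil ?size_adj_matrix.
rewrite (nth_map (Ordinal lt)) ?size_enum_ord //= => le.
by rewrite nth_default // size_map size_enum_ord.
Qed.

Lemma near_adj G (i j : 'I_(nverts G)) : near (adj_matrix G) i j = (i == j) || adj i j.
Proof. by rewrite /near entry_adj. Qed.

Lemma nearxx M : reflexive (near M).
Proof. by move=> u; rewrite /near eqxx. Qed.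

(** Entries outside the matrix default to [false], which gives symmetry on all naturals. *)
Lemma nearC G : symmetric (near (adj_matrix G)).
Proof.
move=> u v; rewrite /near eq_sym; congr orb.
have [lu|leu] := ltnP u (nverts G); last by rewrite !entry_out ?leu ?orbT.
have [lv|lev] := ltnP v (nverts G); last by rewrite !entry_out ?lev ?orbT.
by rewrite (entry_adj (Ordinal lu) (Ordinal lv)) (entry_adj (Ordinal lv) (Ordinal lu)) adj_sym.
Qed.

(** * The kernel graph *)

Section Kernel.
Variables (t : nat) (x : graph * nat).
Let G := x.1.
Let n := nverts G.
Let M := adj_matrix G.
Let vs := iota 0 n.
Let uvs : uniq vs := iota_uniq 0 n.

Definition kverts := kernel_vertices t (adj_matrix x.1, x.2).

Lemma kvertsE : kverts = kernel (near M) vs t x.2.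
Proof. by rewrite /kverts /kernel_vertices /= size_adj_matrix. Qed.

Lemma kverts_lt (i : 'I_(size kverts)) : nth 0 kverts i < nverts x.1.
Proof.
have := mem_nth 0 (ltn_ord i); move: (nth _ _ _) => v.
by rewrite kvertsE mem_filter mem_iota => /andP[].
Qed.

Definition kvert (i : 'I_(size kverts)) : 'I_(nverts x.1) := Ordinal (kverts_lt i).

Lemma uniq_kverts : uniq kverts.
Proof. by rewrite kvertsE filter_uniq. Qed.

Lemma kvert_inj : injective kvert.
Proof.
move=> i j /(congr1 val) /= /eqP.
by rewrite nth_uniq ?uniq_kverts // => /eqP/val_inj.
Qed.

Definition kadj : rel 'I_(size kverts) := [rel i j | adj (kvert i) (kvert j)].
Lemma kadj_sym : symmetric kadj. Proof. by move=> i j; apply: adj_sym. Qed.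
Lemma kadj_irr : irreflexive kadj. Proof. by move=> i; apply: adj_irr. Qed.
Definition kgraph : graph := Graph kadj_sym kadj_irr.

Lemma adj_matrix_kgraph : reduce t (M, x.2) = (adj_matrix kgraph, x.2).
Proof.
rewrite /reduce -/kverts; congr pair; rewrite /adj_matrix /=.
set L := [seq val (kvert i) | i <- enum 'I_(size kverts)].
have EL : L = kverts.
  apply: (@eq_from_nth _ 0) => [|i]; rewrite size_map size_enum_ord // => lti.
  by rewrite (nth_map (Ordinal lti)) ?size_enum_ord //= nth_enum_ord.
transitivity [seq [seq entry M u v | v <- L] | u <- L]; first by rewrite EL.
rewrite -map_comp; apply: eq_map => i /=; rewrite -map_comp; apply: eq_map => j /=.
exact: (entry_adj (kvert i) (kvert j)).
Qed.

Lemma cds_graph (S : {set 'I_n}) :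
  connected_dominating S = cdsb (near M) vs (map val (enum S)).
Proof.
rewrite (connected_dominatingE (nb := near M) (g := val)) ?val_enum_ord //.
- exact: nearC.
- exact: nearxx.
- exact: val_inj.
exact: near_adj.
Qed.

Lemma kvert_enum : map (fun i => val (kvert i)) (enum 'I_(size kverts)) = kverts.
Proof.
apply: (@eq_from_nth _ 0) => [|i]; rewrite size_map size_enum_ord // => lti.
by rewrite (nth_map (Ordinal lti)) ?size_enum_ord //= nth_enum_ord.
Qed.

Lemma cds_kgraph (S : {set 'I_(nverts kgraph)}) :
  connected_dominating S =
    cdsb (near M) kverts (map (fun i => val (kvert i)) (enum S)).
Proof.
rewrite (@connected_dominatingE kgraph (near M) (fun i => val (kvert i))).
- by rewrite kvert_enum.
- exact: nearC.
- exact: nearxx.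
- by move=> i j /val_inj/kvert_inj.
by move=> i j; rewrite near_adj (inj_eq kvert_inj).
Qed.

(** The fallback serves solutions of more than [k] vertices, already of value k + 1, and those of
    infinite value. *)
Definition klift (S : {set 'I_(nverts kgraph)}) : {set 'I_n} :=
  let S' := [set kvert i | i in S] in
  if connected_dominating S' then S' else [set: 'I_n].

Lemma mem_kvert_set (S : {set 'I_(size kverts)}) :
  map val (enum [set kvert i | i in S]) =i map (fun i => val (kvert i)) (enum S).
Proof.
move=> v; apply/mapP/mapP => [[u]|[i]]; rewrite mem_enum.
  by case/imsetP => i iS -> ->; exists i; rewrite ?mem_enum.
by move=> iS ->; exists (kvert i); rewrite // mem_enum imset_f.
Qed.

Lemma klift_seq (S : {set 'I_(size kverts)}) y :
  vset_code (klift S) =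
    enc (lift_seq t ((M, x.2), (y, [seq i \in S | i <- enum 'I_(size kverts)]))).
Proof.
rewrite /klift /lift_seq /= -/kverts size_adj_matrix -/n -/vs.
set T := [seq nth 0 kverts i | i <- _].
have memT : map val (enum [set kvert i | i in S]) =i T.
  move=> v; rewrite mem_kvert_set; apply/mapP/mapP => [[i]|[i]].
    rewrite mem_enum => iS ->; exists (val i) => //.
    rewrite mem_filter mem_iota /= ltn_ord andbT.
    by rewrite (nth_map i) ?size_enum_ord // nth_ord_enum.
  rewrite mem_filter mem_iota => /andP[bi /= lti] ->.
  exists (Ordinal lti) => //; rewrite mem_enum.
  by move: bi; rewrite (nth_map (Ordinal lti)) ?size_enum_ord // (nth_ord_enum _ (Ordinal lti)).
rewrite cds_graph (cdsb_eq_mem _ (nearC G) (@nearxx M) memT) /vset_code.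
have vsE : vs = map val (enum 'I_n) by rewrite val_enum_ord.
case: ifP => _; congr tlist; rewrite vsE -!map_comp; apply: eq_map => i /=.
  by rewrite -memT mem_map ?mem_enum //; apply: val_inj.
by rewrite inE.
Qed.

Lemma kgraph_biclique_free d : biclique_free d G -> biclique_free d kgraph.
Proof.
move=> bf [P [Q [cP cQ disPQ adjPQ]]]; apply: bf.
exists [set kvert i | i in P], [set kvert i | i in Q]; split.
- by rewrite card_imset ?cP //; apply: kvert_inj.
- by rewrite card_imset ?cQ //; apply: kvert_inj.
- by rewrite (imset_disjoint kvert_inj).
by move=> a b /imsetP[i iP ->] /imsetP[j jQ ->]; apply: adjPQ.
Qed.

Lemma biclique_free_near d : biclique_free d G -> biclique_free_on (near M) vs d.
Proof.
move=> bf p q up uq pvs qvs szp szq disj; apply/negP => all_pq; apply: bf.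
have card (r : seq nat) : uniq r -> {subset r <= vs} -> #|[set i : 'I_n | val i \in r]| = size r.
  move=> ur rvs; rewrite cardE -(size_map val); apply/perm_size/uniq_perm => //.
    by rewrite map_inj_uniq ?enum_uniq //; apply: val_inj.
  move=> v; apply/mapP/idP => [[i]|vr]; first by rewrite mem_enum inE => ir ->.
  have := rvs v vr; rewrite mem_iota => /= ltv.
  by exists (Ordinal ltv); rewrite // mem_enum inE.
exists [set i | val i \in p], [set i | val i \in q]; split; rewrite ?card //.
  apply/pred0P => i /=; rewrite !inE; apply/negP => /andP[ip iq].
  by case/hasP: disj; exists (val i).
move=> a b; rewrite !inE => ap bq.
have := allP (allP all_pq _ ap) _ bq; rewrite near_adj => /predU1P[eab|//].
by case/hasP: disj; exists (val b); rewrite //= -eab.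
Qed.

Lemma kgraph_cds r (D : {set 'I_n}) : 0 < r -> t = r.*2 + 3 ->
  connected_dominating D -> #|D| <= x.2 ->
  exists (D' : {set 'I_(nverts kgraph)}) c, [/\ connected_dominating D',
    #|D'| <= #|D| + 4 * c & r * c <= #|D|].
Proof.
move=> r0 Et; rewrite cds_graph => /andP[/allP dom /(connbP (nearC G) (@nearxx M)) cD] leD.
have [|||E [c [EK cE domE szE szc]]] := @approx_cds _ _ (nearC G) (@nearxx M) uvs
    r x.2 (map val (enum D)) r0 _ _ _ dom cD.
- by rewrite map_inj_uniq ?enum_uniq //; apply: val_inj.
- by move=> v /mapP[i _ ->]; rewrite mem_iota /= ltn_ord.
- by rewrite size_map -cardE.
rewrite size_map -cardE in szE szc.
pose D' := [set i : 'I_(size kverts) | val (kvert i) \in E].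
have memD' : map (fun i => val (kvert i)) (enum D') =i E.
  move=> v; apply/mapP/idP => [[i]|vE]; first by rewrite mem_enum inE => iE ->.
  have /(nthP 0)[i lti Ev] : v \in kverts.
    rewrite kvertsE mem_filter Et EK //=.
    exact: kept_sub (EK _ vE).
  by exists (Ordinal lti); rewrite ?mem_enum ?inE /= ?Ev.
exists D', c; split=> //.
- rewrite cds_kgraph (cdsb_eq_mem _ (nearC G) (@nearxx M) memD').
  apply/andP; split; last exact/(connbP (nearC G) (@nearxx M)).
  by apply/allP => v; rewrite kvertsE mem_filter => /andP[_ /domE].
- apply: leq_trans szE; rewrite cardE -(size_map (fun i => val (kvert i))).
  apply: uniq_leq_size => [|v]; last by rewrite memD'.
  by rewrite map_inj_uniq ?enum_uniq // => i j /val_inj/kvert_inj.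
Qed.

Lemma kgraph_lift (S : {set 'I_(nverts kgraph)}) : connected_dominating S ->
  #|S| <= x.2 -> connected_dominating [set kvert i | i in S].
Proof.
rewrite cds_kgraph cds_graph (cdsb_eq_mem _ (nearC G) (@nearxx M) (mem_kvert_set S)).
move=> /andP[/allP dom cS] leS; apply/andP; split=> //; apply/allP.
set D := map _ _ in dom cS *.
apply: (core_core (nearC G) uvs (k := x.2)) => [v||v vZ].
- by case/mapP => i _ ->; rewrite mem_iota; exact: kverts_lt.
- by rewrite size_map -cardE.
apply: dom; rewrite kvertsE mem_filter mem_cat vZ /=.
exact: mem_subseq (core_sub _ _ _) _ vZ.
Qed.

(** With K = max(k, 2), factors are absorbed by e <= K^e: |Z| + 1 is at most K^(2d), one more than
    the number of traces at most K^(4d^2), the tuples contribute K^(5d^2 t), and adding Z at most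
    doubles this. *)
Lemma size_kgraph d : 0 < d -> 2 < t -> biclique_free d G ->
  nverts kgraph <= maxn x.2 2 ^ (6 * d ^ 2 * t).
Proof.
move=> d0 t2 /biclique_free_near bf; rewrite [nverts _]/= kvertsE.
have := size_kept (nearC G) uvs d0 bf t x.2; have := size_core uvs d0 bf x.2.
set Z := size (core _ _ _); set k := maxn _ _ => leZ leK.
apply: leq_trans (_ : _ <= size (kept (near M) vs t x.2)) _.
  by apply: uniq_leq_size => [|v]; [rewrite filter_uniq|rewrite mem_filter => /andP[]].
apply: leq_trans leK _; have k2 : 1 < k by rewrite leq_max orbT.
have ltk e : e <= k ^ e by apply/ltnW/ltn_expl.
have le2d : 2 * d <= k ^ d.
  apply: (@leq_trans (2 ^ d)); last exact: leq_expl.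
  by case: (d) d0 => // e _; rewrite expnS leq_pmul2l // ltn_expl.
have le1 : Z.+1 <= k ^ (2 * d).
  by apply: leq_trans leZ _; rewrite [k ^ (2 * d)](_ : _ = k ^ d * k ^ d) ?leq_mul // -expnD addnn mul2n.
have le2 : (2 * d * Z.+1 ^ d).+1 <= k ^ (4 * d ^ 2).
  apply: (@leq_trans (k ^ (3 * d ^ 2)).+1).
    rewrite ltnS; apply: (@leq_trans (k ^ d * (k ^ (2 * d)) ^ d)).
      by rewrite leq_mul // leq_expl.
    by rewrite -expnM -expnD leq_pexp2l ?(ltnW k2) //; nia.
  apply: (@leq_trans (k ^ (3 * d ^ 2).+1)); last by rewrite leq_pexp2l ?(ltnW k2) //; nia.
  rewrite [k ^ _.+1]expnS; have : 0 < k ^ (3 * d ^ 2) by rewrite expn_gt0 ltnW.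
  by move: (k ^ _) => m m0; apply: (@leq_trans (2 * m)); [lia|rewrite leq_mul2r k2 orbT].
have le3 : t * (2 * d * Z.+1 ^ d).+1 ^ t <= k ^ (5 * d ^ 2 * t).
  apply: (@leq_trans (k ^ t * (k ^ (4 * d ^ 2)) ^ t)).
    by rewrite leq_mul // leq_expl.
  by rewrite -expnM -expnD leq_pexp2l ?(ltnW k2) //; nia.
have le4 : Z <= k ^ (5 * d ^ 2 * t).
  by rewrite ltnW // (leq_trans le1) // leq_pexp2l ?(ltnW k2) //; nia.
apply: leq_trans (leq_add le4 le3) _.
apply: (@leq_trans (k ^ (5 * d ^ 2 * t).+1)); last by rewrite leq_pexp2l ?(ltnW k2) //; nia.
by rewrite addnn -mul2n [k ^ _.+1]expnS leq_mul2r k2 orbT.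
Qed.

End Kernel.

Local Open Scope ring_scope.


(** * Quotients of values by optima *)

Section Ratio.
Variable R : realType.
Implicit Types (o v : \bar R).

Lemma ratio_fin (a b : R) : 0 < b -> Defs.ratio a%:E b%:E = (a / b)%:E.
Proof.
move=> b0; rewrite /Defs.ratio; case: eqVneq => [[->]|_]; first by rewrite divff ?gt_eqF.
by rewrite inver gt_eqF.
Qed.

Lemma ratio_zero v : (0 < v)%E -> Defs.ratio v 0%E = +oo%E.
Proof. by move=> v0; rewrite /Defs.ratio gt_eqF // inve0 gt0_muley. Qed.

Lemma ratio_infty (b : R) : 0 <= b -> Defs.ratio +oo%E b%:E = +oo%E.
Proof.
rewrite le_eqVlt => /predU1P[<-|b0]; first by rewrite ratio_zero ?ltry.
by rewrite /Defs.ratio /= inver gt_eqF // gt0_mulye // lte_fin invr_gt0.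
Qed.

Lemma ratio_ge1 o v : (0 <= o)%E -> (o <= v)%E -> (1 <= Defs.ratio v o)%E.
Proof.
case: o => [b| |] //; last by move=> _; case: v => // _; rewrite /Defs.ratio eqxx.
rewrite lee_fin le_eqVlt => /predU1P[<-|b0].
  rewrite le_eqVlt => /predU1P[<-|v0]; first by rewrite /Defs.ratio eqxx.
  by rewrite ratio_zero ?leey.
case: v => [a| |] // ba; last by rewrite ratio_infty ?leey // ltW.
by rewrite ratio_fin // lee_fin ler_pdivlMr // mul1r -lee_fin.
Qed.

(** For positive reals, v / b <= v' / b <= (1 + e) v' / o. The other cases are v = b, where the
    ratio is 1 by convention even for b = 0, and those where the ratio on the right is infinite. *)
Lemma ratio_transfer (e b : R) o v v' : 0 <= e -> (0 <= o)%E -> (o <= v')%E ->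
  0 <= b -> (b%:E <= v)%E -> (v <= v')%E -> (v != +oo)%E ->
  (o <= ((1 + e) * b)%:E)%E ->
  (Defs.ratio v b%:E <= (1 + e)%:E * Defs.ratio v' o)%E.
Proof.
move=> e0 o0 ov' b0 bv vv' vfin ob.
have e1 : 0 < 1 + e by rewrite ltr_pwDl.
have toy : ((1 + e)%:E * +oo = +oo :> \bar R)%E by rewrite gt0_muley.
have [->|vb] := eqVneq v b%:E.
  rewrite {1}/Defs.ratio eqxx -[1%E]mule1; apply: lee_pmul => //.
    by rewrite lee_fin lerDl.
  exact: ratio_ge1.
have {}bv : (b%:E < v)%E by rewrite lt_neqAle eq_sym vb.
case: o o0 ov' ob => [c| |] // c0 cv' cb.
have v'0 : (0 < v')%E by apply: lt_le_trans vv'; apply: le_lt_trans bv; rewrite lee_fin.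
move: c0; rewrite lee_fin le_eqVlt => /predU1P[c0|c0].
  by rewrite -c0 ratio_zero // toy leey.
case: v' vv' cv' v'0 => [a'| |] // vv' cv' v'0; last by rewrite ratio_infty ?toy ?leey // ltW.
case: v vfin vb bv vv' => [a| |] // _ _ bv vv'.
rewrite !lee_fin !lte_fin in bv vv' cv' v'0 cb *.
have {}b0 : 0 < b by rewrite -(pmulr_rgt0 _ e1) (lt_le_trans c0).
rewrite !ratio_fin // -EFinM lee_fin ler_pdivrMr //.
have -> : (1 + e) * (a' / c) * b = a' * ((1 + e) * b) / c by ring.
by rewrite ler_pdivlMr // ler_pM // ltW // (lt_trans b0).
Qed.

Variables (P : pmin_problem R).

Lemma opt_le (I : inst P) k (s : sol I) : (opt I k <= value P I k s)%E.
Proof. exact: bigmin_le. Qed.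

Lemma opt_attained (I : inst P) k :
  opt I k = +oo%E \/ exists s, opt I k = value P I k s.
Proof.
rewrite /opt; elim/big_ind: _ => [|x y Hx Hy|s _]; first by left.
  by rewrite minEle; case: ifP.
by right; exists s.
Qed.

End Ratio.

(** * The approximation factor *)

Section CDSKernel.
Variable R : realType.
Implicit Types (x : graph * nat) (k : nat).

(** Every vertex lies in the connected set [D] or next to it. So the fallback of [klift] has finite
    value whenever the optimum is finite. *)
Lemma cds_setT (G : graph) (D : {set 'I_(nverts G)}) :
  connected_dominating D -> connected_dominating [set: 'I_(nverts G)].
Proof.
move=> /andP[/forallP dom cD]; apply/andP; split.
  by apply/forallP => v; rewrite inE.
have symT : connect_sym (induced_adj [set: 'I_(nverts G)]).
  by apply: sym_connect_sym => u v; rewrite /induced_adj /= !inE adj_sym.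
have toD u : exists2 w, w \in D & connect (induced_adj setT) u w.
  have /orP[uD|/existsP[w /andP[wD awu]]] := dom u; first by exists u.
  by exists w => //; apply: connect1; rewrite /induced_adj /= !inE adj_sym.
apply/forallP => u; apply/implyP => _; apply/forallP => v; apply/implyP => _.
have [u' u'D uu'] := toD u; have [v' v'D vv'] := toD v.
apply: connect_trans uu' (connect_trans _ _); last by rewrite symT; exact: vv'.
have /implyP/(_ u'D)/forallP/(_ v')/implyP/(_ v'D) := forallP cD u'.
by apply: connect_sub => a b /and3P[_ _ ab]; apply: connect1; rewrite /induced_adj /= !inE.
Qed.

Lemma cds_value_ge0 (G : graph) k (S : {set 'I_(nverts G)}) :
  (0 <= value (CDS R) G k S)%E.
Proof. by rewrite /=; case: ifP => _; rewrite ?leey // lee_fin ler0n. Qed.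

Lemma cds_opt_ge0 (G : graph) k : (0 <= @opt R (CDS R) G k)%E.
Proof.
have [->|[S ->]] := @opt_attained R (CDS R) G k; first exact: leey.
exact: (@cds_value_ge0 G k S).
Qed.

Lemma klift_ratio (eps : R) r x (S' : {set 'I_(nverts (kgraph (r.*2 + 3) x))}) :
  (0 < r)%N -> 0 < eps -> 4 <= eps * r%:R ->
  (Defs.ratio (value (CDS R) x.1 x.2 (klift S')) (@opt R (CDS R) x.1 x.2) <=
   (1 + eps)%:E * Defs.ratio (value (CDS R) (kgraph (r.*2 + 3) x) x.2 S')
     (@opt R (CDS R) (kgraph (r.*2 + 3) x) x.2))%E.
Proof.
move=> r0 eps0 epsr.
set t := (r.*2 + 3)%N in S' *; set G := x.1; set k := x.2; set G' := kgraph t x in S' *.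
have o'0 := cds_opt_ge0 G' k; have o'v' := @opt_le R (CDS R) G' k S'.
have ov := @opt_le R (CDS R) G k (klift S'); have o0 := cds_opt_ge0 G k.
(* An optimal lift leaves nothing to show, as the ratio in the kernel is at least 1. This settles an
   infinite optimum and an optimum of k + 1. *)
have ratio1 : (Defs.ratio (value (CDS R) G k (klift S')) (@opt R (CDS R) G k) = 1 ->
    Defs.ratio (value (CDS R) G k (klift S')) (@opt R (CDS R) G k) <=
   (1 + eps)%:E * Defs.ratio (value (CDS R) G' k S') (@opt R (CDS R) G' k))%E.
  move=> ->; rewrite -[1%E]mule1; apply: lee_pmul => //; last exact: ratio_ge1.
  by rewrite lee_fin lerDl ltW.
have [oE|[D oE]] := @opt_attained R (CDS R) G k.
  apply: ratio1; rewrite oE in ov *; move: ov; rewrite leye_eq => /eqP->.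
  by rewrite /Defs.ratio eqxx.
have [cD|ncD] := boolP (connected_dominating D); last first.
  have {}oE : @opt R (CDS R) G k = +oo%E by rewrite oE /= (negPf ncD).
  apply: ratio1; rewrite oE in ov *; move: ov; rewrite leye_eq => /eqP->.
  by rewrite /Defs.ratio eqxx.
have cL : connected_dominating (klift S').
  by rewrite /klift; case: ifP => // _; apply: cds_setT cD.
have vE : value (CDS R) G k (klift S') = ((minn #|klift S'| k.+1)%:R)%:E by rewrite /= cL.
have {}oE : @opt R (CDS R) G k = ((minn #|D| k.+1)%:R)%:E by rewrite oE /= cD.
have [leD|ltD] := leqP #|D| k; last first.
  apply: ratio1; rewrite /Defs.ratio vE oE (minn_idPr ltD).
  rewrite vE oE (minn_idPr ltD) lee_fin ler_nat in ov.
  by rewrite (_ : minn _ _ = k.+1) ?eqxx //; apply/eqP; rewrite eqn_leq geq_minr ov.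
rewrite (minn_idPl (leqW leD)) in oE.
have [D' [c [cD' szD' szc]]] := kgraph_cds r0 erefl cD leD.
rewrite oE; apply: ratio_transfer; rewrite ?ler0n ?(ltW eps0) ?vE -?oE -?vE //.
(* The lifted value is at most the kernel value: above [k] vertices the latter is k + 1, and up to
   [k] vertices the lift is the image of [S'], of the same size. *)
- have [cS|ncS] := boolP (connected_dominating S'); last first.
    by rewrite {2}/value /= (negPf ncS) leey.
  rewrite vE /= cS lee_fin ler_nat.
  have [leS|ltS] := leqP #|S'| k; last by rewrite [leqRHS](minn_idPr ltS) geq_minr.
  have cS2 : connected_dominating [set kvert i | i in S'] by exact: kgraph_lift.
  by rewrite /klift cS2 card_imset //; apply: kvert_inj.
- by rewrite vE.
apply: le_trans (@opt_le R (CDS R) G' k D') _; rewrite /= cD' lee_fin.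
apply: (@le_trans _ _ (#|D| + 4 * c)%:R); first by rewrite ler_nat (leq_trans (geq_minl _ _)).
(* The surplus satisfies 4c <= eps r c <= eps |D|. *)
rewrite natrD natrM [(1 + eps) * _]mulrDl mul1r lerD2l.
have : (r * c)%:R <= #|D|%:R :> R by rewrite ler_nat.
rewrite natrM => le; apply: (@le_trans _ _ (eps * (r%:R * c%:R))); last by rewrite ler_pM2l.
by rewrite mulrA ler_wpM2r ?ler0n.
Qed.

End CDSKernel.

Lemma esize_seq_le A (EA : encodable A) (s : seq A) (m : nat) :
  (forall i, (i < size s)%N -> forall a, (esize (nth a s i) <= m)%N) ->
  (esize s <= (size s * m.+1).+1)%N.
Proof.
elim: s => // a s IHs H; rewrite esize_cons /= mulSn.
have := H 0 isT a; have := IHs (fun i lti => H i.+1 lti); rewrite /=; lia.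
Qed.

Lemma esize_adj_matrix (G : graph) N : (nverts G <= N)%N ->
  (esize (adj_matrix G) <= (N * (N * 4).+2).+1)%N.
Proof.
move=> leN; apply: leq_trans (esize_seq_le (m := (N * 4).+1) _) _; last first.
  by rewrite size_adj_matrix ltnS leq_mul2r leN orbT.
move=> i; rewrite size_adj_matrix => lti a; rewrite (nth_map (Ordinal lti)) ?size_enum_ord //.
apply: leq_trans (esize_seq_le (m := 3) _) _ => [j _ b|]; first exact: esize_bool.
by rewrite size_map size_enum_ord ltnS leq_mul2r leN orbT.
Qed.

Unset Implicit Arguments.

(* The constant hidden in the exponent O(d^2/eps) is absolute. *)
Theorem theorem20 (R : realType) :
  exists C : nat, forall (d : nat) (eps : R), (0 < d)%N -> 0 < eps ->
    @approx_kernel R (CDS R) (biclique_free d) (1 + eps) nverts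
      (fun k => (maxn k 2)%:R `^ (C%:R * d%:R ^+ 2 / Num.min eps 1)).
Proof.
(* 78 is 6 times 13: the size bound has exponent 6 d^2 t, and t = 2r + 3 <= 8 / eps + 5 <= 13 /
   min(eps, 1). *)
exists 78 => d eps d0 eps0.
(* The least integer above 4 / eps, as [klift_ratio] asks for 4 <= eps r. *)
pose r := (Num.truncn (4 / eps)).+1; pose t := (r.*2 + 3)%N.
have t2 : (2 < t)%N by rewrite /t; lia.
have eps4 : 0 <= 4 / eps by rewrite divr_ge0 // ltW.
have /andP[r_le r_gt] := truncn_itv eps4.
exists (fun x => (kgraph t x, x.2)), (fun x S => klift S); split; [split|..].
- by move=> x; apply: kgraph_biclique_free.
- apply: (@polytime_ptime _ _ _ _ _ _ _ _
    (fun x : graph * nat => (adj_matrix x.1, x.2)) (reduce t)).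
  + by move=> x; rewrite /input_code /= graph_codeE.
  + by move=> x; rewrite /input_code /= graph_codeE adj_matrix_kgraph.
  + exact: ptime_reduce.
- pose i (y : {x : graph * nat & {set 'I_(nverts (kgraph t x))}}) :=
    ((adj_matrix (tag y).1, (tag y).2), ((adj_matrix (kgraph t (tag y)), (tag y).2),
      [seq i \in tagged y | i <- enum 'I_(nverts (kgraph t (tag y)))])).
  apply: (@polytime_ptime _ _ _ _ _ _ _ _ i (lift_seq t)).
  + move=> [x S]; rewrite /input_code /= !graph_codeE; congr (Node _ (Node _ _)).
    by rewrite /vset_code /enc /= /enc_seq -map_comp.
  + by move=> [x S]; rewrite /= (klift_seq S (adj_matrix (kgraph t x), x.2)).
  + exact: ptime_lift_seq.
- move=> x S' _; apply: klift_ratio => //.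
  by rewrite mulrC -ler_pdivrMr // ltW.
- exists (fun k => let N := maxn k 2 ^ (6 * d ^ 2 * t) in ((N * (N * 4).+2).+1 + k.*2.+1).+1)%N.
  move=> x bf; rewrite /input_code /= graph_codeE ltnS leq_add //.
    by apply: esize_adj_matrix; apply: (size_kgraph d0).
  by rewrite -[leqLHS]/(esize x.2) esize_nat.
move=> x bf; apply: (@le_trans _ _ ((maxn x.2 2)%:R ^+ (6 * d ^ 2 * t))).
  by rewrite -natrX ler_nat; apply: (size_kgraph d0).
rewrite -powR_mulrn ?ler0n //; apply: ler_powR.
  by rewrite (@ler_nat _ 1) leq_max orbT.
set m := Num.min eps 1.
have m0 : 0 < m by rewrite lt_min eps0 ltr01.
have m1 : 1 <= m^-1 by rewrite invf_ge1 // ge_min lexx orbT.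
have em : 4 / eps <= 4 / m by rewrite ler_pM2l ?ltr0n // lef_pV2 ?posrE // ge_min lexx.
have tm : t%:R <= 13 / m.
  rewrite /t natrD -mul2n natrM /r -natr1.
  by move: r_le em m1; set q := _%:R; set u := 4 / eps; lra.
have : 0 <= d%:R ^+ 2 * (13 / m - t%:R) by rewrite mulr_ge0 ?subr_ge0 // exprn_ge0 ?ler0n.
rewrite natrM (natrM _ 6) natrX; move: (d%:R ^+ 2) (m^-1) (t%:R) => a b c; lra.
Qed.
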